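(* Let $c,h,h_W\in\mathbb{C}$ and $p\in\mathbb{N}$ be such that $2h_W+\frac{p^2-1}{12}c=0$. If $V(c,h,h_W)$ contains a subsingular vector $u$ such that $\overline{u}=L_{-p}^r v$ for some $r\in\mathbb{N}$, then $h=h_W+\frac{(13p+1)(p-1)}{12}+\frac{(1-r)p}{2}$.
   Context: $\mathbb{N}=\{1,2,\dots\}$. $\mathcal{L}=W(2,2)$ is the complex Lie algebra with basis $\{W_n,L_n,C:n\in\mathbb{Z}\}$ and brackets $[L_n,L_m]=(n-m)L_{n+m}+\delta_{n,-m}\frac{n^3-n}{12}C$, $[L_n,W_m]=(n-m)W_{n+m}+\delta_{n,-m}\frac{n^3-n}{12}C$, $[W_n,W_m]=0$, $[\mathcal{L},C]=0$. Put $\mathcal{L}_{\pm}=\bigoplus_{n>0}(\mathbb{C}L_{\pm n}+\mathbb{C}W_{\pm n})$. $U(\cdot)$ denotes the universal enveloping algebra. The Verma module $V(c,h,h_W)$ is the quotient of $U(\mathcal{L})$ by the left ideal generated by $L_n,W_n$ ($n\in\mathbb{N}$), $C-c$, $L_0-h$, $W_0-h_W$; $v$ is the image of $1$. It has the PBW basis $W_{-m_s}\cdots W_{-m_1}L_{-n_t}\cdots L_{-n_1}v$ with $m_s\ge\cdots\ge m_1\ge1$, $n_t\ge\cdots\ge n_1\ge1$ ($s,t\ge0$). $V(c,h,h_W)_{h+k}$ is the $L_0$-eigenspace of eigenvalue $h+k$. The $W$-degree of the PBW vector $W_{-m_s}\cdots W_{-m_1}L_{-n_t}\cdots L_{-n_1}v$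 is $s$. For nonzero $x\in V(c,h,h_W)$, written in the PBW basis, $\overline{x}$ is its lowest nonzero homogeneous component with respect to $W$-degree. $\mathcal{W}$ is the span of the vectors $W_{-m_s}\cdots W_{-m_1}v$. A singular vector in a module is a nonzero $L_0$-eigenvector annihilated by $\mathcal{L}_+$. With $p$ as in the claim, $u'$ denotes a singular vector in $V(c,h,h_W)_{h+p}\cap\mathcal{W}$ with $\overline{u'}=W_{-p}v$; put $J'(c,h,h_W)=U(\mathcal{L})u'$ and $L'(c,h,h_W)=V(c,h,h_W)/J'(c,h,h_W)$. A subsingular vector is an $L_0$-eigenvector $u\in V(c,h,h_W)$ whose image in $L'(c,h,h_W)$ is a singular vector (the case that $u$ is itself singular in $V(c,h,h_W)$ is allowed). *)

(* Defs.v *)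
From HB Require Import structures.
From mathcomp Require Import all_boot all_order all_algebra.
From mathcomp Require Import finmap.
From mathcomp Require Import boolp classical_sets reals complex.
From mathcomp Require Import monalg.
From mathcomp Require Import generic_quotient ring_quotient.
From mathcomp Require Import ring zify.

Set Implicit Arguments.
Unset Strict Implicit.
Unset Printing Implicit Defensive.

Import GRing.Theory.
Local Open Scope ring_scope.
Local Open Scope quotient_scope.
Local Open Scope classical_set_scope.

Section ModuleQuotient.
Variables (A : nzRingType) (M : lmodType A) (S : set M).

Inductive submod_gen : M -> Prop :=
| submod_gen_in x : S x -> submod_gen x
| submod_gen0 : submod_gen 0
| submod_genD x y : submod_gen x -> submod_gen y -> submod_gen (x + y)
| submod_genZ a x : submod_gen x -> submod_gen (a *: x).

Definition submod_pred (x : M) : bool := `[< submod_gen x >].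

Lemma submod_predP x : reflect (submod_gen x) (x \in submod_pred).
Proof. exact: asboolP. Qed.

Lemma submod_zmod_closed : zmod_closed submod_pred.
Proof.
split=> [|x y /submod_predP Sx /submod_predP Sy]; apply/submod_predP.
  exact: submod_gen0.
by rewrite -[- y]scaleN1r; apply: submod_genD => //; apply: submod_genZ.
Qed.

HB.instance Definition _ := GRing.isZmodClosed.Build M submod_pred
  submod_zmod_closed.
Definition submod_zmodClosed : zmodClosed M :=
  GRing.ZmodClosed.clone M submod_pred _.

Definition lquot : Type := Quotient.quot submod_zmodClosed.
HB.instance Definition _ := GRing.Zmodule.on lquot.

Definition lquot_pi (x : M) : lquot := \pi_(Quotient.quot submod_zmodClosed) x.

Lemma lquot_piP x y : lquot_pi x = lquot_pi y <-> submod_gen (x - y).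
Proof.
split=> [|Sxy]; last by apply/eqP; rewrite -Quotient.idealrBE; apply/submod_predP.
by move=> /eqP; rewrite -Quotient.idealrBE => /submod_predP.
Qed.

Lemma lquot_piD x y : lquot_pi (x + y) = lquot_pi x + lquot_pi y.
Proof. by rewrite /lquot_pi !piE. Qed.

Definition lquot_repr (q : lquot) : M :=
  repr (q : Quotient.quot submod_zmodClosed).

Lemma lquot_reprK q : lquot_pi (lquot_repr q) = q.
Proof. exact: (@reprK _ (Quotient.quot submod_zmodClosed)). Qed.

Definition lquot_scale (a : A) (q : lquot) : lquot :=
  lquot_pi (a *: lquot_repr q).

Lemma lquot_scale_pi a x : lquot_scale a (lquot_pi x) = lquot_pi (a *: x).
Proof.
apply/lquot_piP; rewrite -scalerBr; apply: submod_genZ.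
by apply/lquot_piP; rewrite lquot_reprK.
Qed.

Fact lquot_scaleA a b q :
  lquot_scale a (lquot_scale b q) = lquot_scale (a * b) q.
Proof. by rewrite -(lquot_reprK q) !lquot_scale_pi scalerA. Qed.

Fact lquot_scale1 : left_id 1 lquot_scale.
Proof. by move=> q; rewrite -(lquot_reprK q) lquot_scale_pi scale1r. Qed.

Fact lquot_scaleDr : right_distributive lquot_scale +%R.
Proof.
move=> a q s; rewrite -(lquot_reprK q) -(lquot_reprK s).
by rewrite -lquot_piD !lquot_scale_pi scalerDr lquot_piD.
Qed.

Fact lquot_scaleDl q : {morph lquot_scale^~ q : a b / a + b}.
Proof.
move=> a b; rewrite -(lquot_reprK q).
by rewrite !lquot_scale_pi scalerDl lquot_piD.
Qed.

HB.instance Definition _ := GRing.Zmodule_isLmodule.Build A lquot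
  lquot_scaleA lquot_scale1 lquot_scaleDr lquot_scaleDl.

Lemma lquot_pi_is_linear : linear lquot_pi.
Proof. by move=> a x y; rewrite lquot_piD -lquot_scale_pi. Qed.

HB.instance Definition _ := GRing.isLinear.Build A M lquot _ lquot_pi
  lquot_pi_is_linear.

End ModuleQuotient.

HB.mixin Record Lmodule_isLie (K : fieldType) L of GRing.Lmodule K L := {
  lie : L -> L -> L;
  lieDZl : forall a x y z, lie (a *: x + y) z = a *: lie x z + lie y z;
  lieDZr : forall a x y z, lie z (a *: x + y) = a *: lie z x + lie z y;
  liexx : forall x, lie x x = 0;
  lie_jacobi : forall x y z,
    lie x (lie y z) + lie y (lie z x) + lie z (lie x y) = 0
}.

#[short(type="lieAlgType")]
HB.structure Definition LieAlgebra (K : fieldType) :=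
  {L of GRing.Lmodule K L & Lmodule_isLie K L}.

Section EnvelopingAlgebra.
Variables (K : fieldType) (L : lieAlgType K).

(* The free associative algebra on the set underlying L; the linear structure
   of L is imposed by the relations. *)
Local Notation free_alg := {malg K[{fmonom L}]}.

Definition free_gen (x : L) : free_alg := << fmu x >>.

Inductive uea_rel : free_alg -> Prop :=
| uea_rel_linear a x y :
    uea_rel (free_gen (a *: x + y) - (a *: free_gen x + free_gen y))
| uea_rel_lie x y :
    uea_rel (free_gen x * free_gen y - free_gen y * free_gen x
             - free_gen (lie x y)).

Inductive uea_ideal : free_alg -> Prop :=
| uea_ideal_rel x : uea_rel x -> uea_ideal x
| uea_ideal0 : uea_ideal 0
| uea_idealD x y : uea_ideal x -> uea_ideal y -> uea_ideal (x + y)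
| uea_idealMl a x : uea_ideal x -> uea_ideal (a * x)
| uea_idealMr a x : uea_ideal x -> uea_ideal (x * a).

Definition uea_pred (x : free_alg) : bool := `[< uea_ideal x >].

Lemma uea_predP x : reflect (uea_ideal x) (x \in uea_pred).
Proof. exact: asboolP. Qed.

Lemma uea_zmod_closed : zmod_closed uea_pred.
Proof.
split=> [|x y /uea_predP Ix /uea_predP Iy]; apply/uea_predP.
  exact: uea_ideal0.
by rewrite -mulN1r; apply: uea_idealD => //; apply: uea_idealMl.
Qed.

HB.instance Definition _ := GRing.isZmodClosed.Build free_alg uea_pred
  uea_zmod_closed.
Definition uea_zmodClosed : zmodClosed free_alg :=
  GRing.ZmodClosed.clone free_alg uea_pred _.

Definition uea : Type := Quotient.quot uea_zmodClosed.
HB.instance Definition _ := GRing.Zmodule.on uea.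

Definition uea_pi (x : free_alg) : uea := \pi_(Quotient.quot uea_zmodClosed) x.

Lemma uea_piP x y : uea_pi x = uea_pi y <-> uea_ideal (x - y).
Proof.
split=> [|Sxy]; last by apply/eqP; rewrite -Quotient.idealrBE; apply/uea_predP.
by move=> /eqP; rewrite -Quotient.idealrBE => /uea_predP.
Qed.

Lemma uea_piD x y : uea_pi (x + y) = uea_pi x + uea_pi y.
Proof. by rewrite /uea_pi !piE. Qed.

Definition uea_repr (q : uea) : free_alg := repr (q : Quotient.quot uea_zmodClosed).

Lemma uea_reprK q : uea_pi (uea_repr q) = q.
Proof. exact: (@reprK _ (Quotient.quot uea_zmodClosed)). Qed.

Definition uea_one : uea := uea_pi 1.
Definition uea_mul (p q : uea) : uea := uea_pi (uea_repr p * uea_repr q).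
Definition uea_scale (a : K) (q : uea) : uea := uea_pi (a *: uea_repr q).

Lemma uea_mul_pi x y : uea_mul (uea_pi x) (uea_pi y) = uea_pi (x * y).
Proof.
apply/uea_piP.
set x' := uea_repr _; set y' := uea_repr _.
have -> : x' * y' - x * y = x' * (y' - y) + (x' - x) * y.
  by rewrite mulrBr mulrBl addrA subrK.
by apply: uea_idealD; [apply: uea_idealMl | apply: uea_idealMr];
  apply/uea_piP; rewrite uea_reprK.
Qed.

Lemma uea_scale_pi a x : uea_scale a (uea_pi x) = uea_pi (a *: x).
Proof.
apply/uea_piP; rewrite -scalerBr -[_ - _]mul1r scalerAl.
by apply: uea_idealMl; apply/uea_piP; rewrite uea_reprK.
Qed.

Fact uea_mulA : associative uea_mul.
Proof.
move=> p q r; rewrite -(uea_reprK p) -(uea_reprK q) -(uea_reprK r).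
by rewrite !uea_mul_pi mulrA.
Qed.

Fact uea_mul1 : left_id uea_one uea_mul.
Proof. by move=> p; rewrite -(uea_reprK p) uea_mul_pi mul1r. Qed.

Fact uea_mulr1 : right_id uea_one uea_mul.
Proof. by move=> p; rewrite -(uea_reprK p) uea_mul_pi mulr1. Qed.

Fact uea_mulDl : left_distributive uea_mul +%R.
Proof.
move=> p q r; rewrite -(uea_reprK p) -(uea_reprK q) -(uea_reprK r).
by rewrite -uea_piD !uea_mul_pi mulrDl uea_piD.
Qed.

Fact uea_mulDr : right_distributive uea_mul +%R.
Proof.
move=> p q r; rewrite -(uea_reprK p) -(uea_reprK q) -(uea_reprK r).
by rewrite -uea_piD !uea_mul_pi mulrDr uea_piD.
Qed.

Lemma uea_ideal_augmentation x : uea_ideal x -> x@_(@mone {fmonom L}) = 0.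
Proof.
have gen0 y : (free_gen y)@_(@mone {fmonom L}) = 0.
  rewrite /free_gen mcoeffU; case: eqP => // /(congr1 (@fdeg L)).
  by rewrite fdegU fdeg1.
elim=> {x} [x| | x y _ x0 _ y0 | a x _ x0 | a x _ x0].
- case=> [a y z|y z].
    by rewrite mcoeffB mcoeffD mcoeffZ !gen0 mulr0 addr0 subr0.
  rewrite !mcoeffB !gen0 subr0.
  by rewrite !(rmorphM (mcoeff (@mone {fmonom L}))) /= !gen0 !mulr0 subr0.
- exact: mcoeff0.
- by rewrite mcoeffD x0 y0 addr0.
- by rewrite (rmorphM (mcoeff (@mone {fmonom L}))) /= x0 mulr0.
- by rewrite (rmorphM (mcoeff (@mone {fmonom L}))) /= x0 mul0r.
Qed.

Fact uea_one_neq0 : uea_one != 0.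
Proof.
apply/eqP => one0; have /uea_ideal_augmentation : uea_ideal (1 - 0).
  by apply/uea_piP; rewrite -/uea_one one0 /uea_pi piE.
by rewrite subr0 mcoeffC eqxx => /eqP; rewrite oner_eq0.
Qed.

HB.instance Definition _ := GRing.Zmodule_isNzRing.Build uea
  uea_mulA uea_mul1 uea_mulr1 uea_mulDl uea_mulDr uea_one_neq0.

Fact uea_scaleA a b q : uea_scale a (uea_scale b q) = uea_scale (a * b) q.
Proof. by rewrite -(uea_reprK q) !uea_scale_pi scalerA. Qed.

Fact uea_scale1 : left_id 1 uea_scale.
Proof. by move=> q; rewrite -(uea_reprK q) uea_scale_pi scale1r. Qed.

Fact uea_scaleDr : right_distributive uea_scale +%R.
Proof.
move=> a q s; rewrite -(uea_reprK q) -(uea_reprK s).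
by rewrite -uea_piD !uea_scale_pi scalerDr uea_piD.
Qed.

Fact uea_scaleDl q : {morph uea_scale^~ q : a b / a + b}.
Proof.
move=> a b; rewrite -(uea_reprK q).
by rewrite !uea_scale_pi scalerDl uea_piD.
Qed.

HB.instance Definition _ := GRing.Zmodule_isLmodule.Build K uea
  uea_scaleA uea_scale1 uea_scaleDr uea_scaleDl.

Fact uea_scaleAl (a : K) (p q : uea) : a *: (p * q) = (a *: p) * q.
Proof.
rewrite -(uea_reprK p) -(uea_reprK q).
change (uea_scale a (uea_mul (uea_pi (uea_repr p)) (uea_pi (uea_repr q))) =
  uea_mul (uea_scale a (uea_pi (uea_repr p))) (uea_pi (uea_repr q))).
by rewrite uea_mul_pi !uea_scale_pi uea_mul_pi scalerAl.
Qed.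

HB.instance Definition _ := GRing.Lmodule_isLalgebra.Build K uea uea_scaleAl.

Definition uea_in (x : L) : uea := uea_pi (free_gen x).

Lemma uea_in_lie x y :
  uea_in (lie x y) = uea_in x * uea_in y - uea_in y * uea_in x.
Proof.
have mulE a b : uea_in a * uea_in b = uea_pi (free_gen a * free_gen b).
  exact: uea_mul_pi.
rewrite !mulE; apply/eqP; rewrite eq_sym subr_eq -uea_piD; apply/eqP/uea_piP.
rewrite opprD addrA addrAC; exact/uea_ideal_rel/uea_rel_lie.
Qed.

Lemma uea_in_is_linear : linear uea_in.
Proof.
move=> a x y; have <- : uea_pi (a *: free_gen x) = a *: uea_in x.
  by rewrite -uea_scale_pi.
rewrite -uea_piD; apply/uea_piP; exact/uea_ideal_rel/uea_rel_linear.
Qed.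

HB.instance Definition _ := GRing.isLinear.Build K L uea _ uea_in
  uea_in_is_linear.

End EnvelopingAlgebra.

Arguments uea_in {K L} x.

(* A module V over a K-algebra A is a K-space through a |-> a%:A. *)
Definition lincomb (K : fieldType) (A : lalgType K) (V : lmodType A)
    (I : choiceType) (b : I -> V) (f : {malg K[I]}) : V :=
  \sum_(i <- msupp f) (f@_i)%:A *: b i.

Variant w22_gen := GL of int | GW of int | GC.

Definition w22_gen_encode (g : w22_gen) : int + int + unit :=
  match g with GL n => inl (inl n) | GW n => inl (inr n) | GC => inr tt end.
Definition w22_gen_decode (s : int + int + unit) : w22_gen :=
  match s with inl (inl n) => GL n | inl (inr n) => GW n | inr _ => GC end.
Lemma w22_gen_encodeK : cancel w22_gen_encode w22_gen_decode.
Proof. by case. Qed.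
HB.instance Definition _ := Choice.copy w22_gen (can_type w22_gen_encodeK).

Section W22.
Variable K : fieldType.

Definition w22 : Type := {malg K[w22_gen]}.
HB.instance Definition _ := GRing.Lmodule.on w22.

Definition Lg (n : int) : w22 := << GL n >>.
Definition Wg (n : int) : w22 := << GW n >>.
Definition Cg : w22 := << GC >>.

(* Meaningful when 12 is invertible in K; otherwise 12%:R^-1 = 0 and the
   Lie algebra axioms below still hold. *)
Definition w22_cocycle (n m : int) : K :=
  if n == - m then (n ^+ 3 - n)%:~R / 12%:R else 0.

(* The value of [W_n, L_m] is forced by antisymmetry: it is - [L_m, W_n]. *)
Definition w22_bracket (g g' : w22_gen) : w22 :=
  match g, g' with
  | GL n, GL m => (n - m)%:~R *: Lg (n + m) + w22_cocycle n m *: Cg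
  | GL n, GW m => (n - m)%:~R *: Wg (n + m) + w22_cocycle n m *: Cg
  | GW n, GL m => (n - m)%:~R *: Wg (n + m) + w22_cocycle n m *: Cg
  | GW _, GW _ => 0
  | GC, _ | _, GC => 0
  end.

Definition w22_lie (x y : w22) : w22 :=
  \sum_(g <- msupp x) \sum_(g' <- msupp y)
    (x@_g * y@_g') *: w22_bracket g g'.

Lemma w22_lin_ext (V : lmodType K) (F : w22_gen -> V) a (x y : w22) :
  \sum_(g <- msupp (a *: x + y)) (a *: x + y)@_g *: F g =
  a *: (\sum_(g <- msupp x) x@_g *: F g) + \sum_(g <- msupp y) y@_g *: F g.
Proof.
pose d := (msupp x `|` msupp y `|` msupp (a *: x + y))%fset.
have ext z : (msupp z `<=` d)%fset ->
    \sum_(g <- msupp z) z@_g *: F g = \sum_(g <- d) z@_g *: F g.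
  move=> zd; apply: big_fset_incl => // g _ /mcoeff_outdom ->.
  by rewrite scale0r.
have [sx sy sz] : [/\ msupp x `<=` d, msupp y `<=` d
    & msupp (a *: x + y) `<=` d]%fset.
  by split; apply/fsubsetP => g gx; rewrite !inE gx ?orbT.
rewrite !ext // scaler_sumr -big_split /=.
by apply: eq_bigr => g _; rewrite mcoeffD mcoeffZ scalerDl scalerA.
Qed.

Let ad (g : w22_gen) (y : w22) : w22 :=
  \sum_(g' <- msupp y) y@_g' *: w22_bracket g g'.

Let lieE x y : w22_lie x y = \sum_(g <- msupp x) x@_g *: ad g y.
Proof.
apply: eq_bigr => g _; rewrite scaler_sumr; apply: eq_bigr => g' _.
by rewrite scalerA.
Qed.

Fact w22_lieDZl a x y z :
  w22_lie (a *: x + y) z = a *: w22_lie x z + w22_lie y z.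
Proof. by rewrite !lieE w22_lin_ext. Qed.

Lemma w22_bracketC g g' : w22_bracket g' g = - w22_bracket g g'.
Proof.
have coc n m : w22_cocycle m n = - w22_cocycle n m.
  rewrite /w22_cocycle.
  have -> : (m == - n) = (n == - m) by rewrite eq_sym eqr_oppLR.
  case: eqP => [->|_]; last by rewrite oppr0.
  by rewrite -mulNr -rmorphN /=; congr (_%:~R / _); ring.
have sub n m : (m - n)%:~R = - (n - m)%:~R :> K by rewrite -rmorphN opprB.
have anti (X : int -> w22) n m :
    (m - n)%:~R *: X (m + n) + w22_cocycle m n *: Cg =
    - ((n - m)%:~R *: X (n + m) + w22_cocycle n m *: Cg).
  by rewrite opprD -!scaleNr -coc -sub (addrC n).
by case: g g' => [n|n|] [m|m|] /=; rewrite ?oppr0 // anti.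
Qed.

Lemma w22_lieC x y : w22_lie y x = - w22_lie x y.
Proof.
rewrite /w22_lie exchange_big -sumrN; apply: eq_bigr => g _.
rewrite -sumrN; apply: eq_bigr => g' _.
by rewrite w22_bracketC scalerN mulrC.
Qed.

Fact w22_lieDZr a x y z :
  w22_lie z (a *: x + y) = a *: w22_lie z x + w22_lie z y.
Proof. by rewrite !(w22_lieC _ z) w22_lieDZl opprD scalerN. Qed.

Lemma w22_ind (P : w22 -> Prop) :
  P 0 -> (forall a g x, P x -> P (a *: (<< g >> : w22) + x)) -> forall x, P x.
Proof.
move=> P0 PD x; rewrite [x]monalgE; elim/big_rec: _ => // g y _ Py.
have -> : << x@_g *g g >> = x@_g *: (<< g >> : w22).
  by apply/malgP => k; rewrite mcoeffZ !mcoeffU mulrnAr mulr1.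
exact: PD.
Qed.

Lemma w22_lieU g g' : w22_lie << g >> << g' >> = w22_bracket g g'.
Proof.
by rewrite /w22_lie !msuppU oner_eq0 !big_seq_fset1 !mcoeffUU mulr1 scale1r.
Qed.

Let lie0l x : w22_lie 0 x = 0.
Proof. by rewrite /w22_lie msupp0 big_seq_fset0. Qed.

Fact w22_liexx x : w22_lie x x = 0.
Proof.
elim/w22_ind: x => [|a g x xx]; first exact: lie0l.
rewrite w22_lieDZl !w22_lieDZr xx addr0 w22_lieU (w22_lieC << g >>).
have -> : w22_bracket g g = 0.
  case: g => [n|n|] //=; rewrite /w22_cocycle subrr scale0r add0r.
  case: eqP => [nn|]; last by rewrite scale0r.
  have -> : n = 0 by lia.
  by rewrite expr0n subrr mul0r scale0r.
by rewrite scaler0 add0r scalerN subrr.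
Qed.

Let add3_rot (V : zmodType) (a b c : V) : a + b + c = b + c + a.
Proof. by rewrite -addrA addrC. Qed.

Let add3_linear (V : lmodType K) (a : K) (x1 x2 y1 y2 z1 z2 : V) :
  (a *: x1 + x2) + (a *: y1 + y2) + (a *: z1 + z2) =
  a *: (x1 + y1 + z1) + (x2 + y2 + z2).
Proof. by rewrite (addrACA (a *: x1)) [LHS]addrACA !scalerDr. Qed.

Let add3_comb (V : lmodType K) (a1 a2 a3 b1 b2 b3 : K) (x y : V) :
  (a1 *: x + b1 *: y) + (a2 *: x + b2 *: y) + (a3 *: x + b3 *: y) =
  (a1 + a2 + a3) *: x + (b1 + b2 + b3) *: y.
Proof. by rewrite (addrACA (a1 *: x)) [LHS]addrACA !scalerDl. Qed.

Let jac x y z :=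
  w22_lie x (w22_lie y z) + w22_lie y (w22_lie z x) + w22_lie z (w22_lie x y).

Let jacC x y z : jac x y z = jac y z x.
Proof. exact: add3_rot. Qed.

Let jacDZ a x x' y z : jac (a *: x + x') y z = a *: jac x y z + jac x' y z.
Proof.
rewrite /jac w22_lieDZl (w22_lieDZr _ _ _ z) w22_lieDZr w22_lieDZl w22_lieDZr.
exact: add3_linear.
Qed.

Let jac0 y z : jac 0 y z = 0.
Proof.
have lie0r x : w22_lie x 0 = 0 by rewrite w22_lieC lie0l oppr0.
by rewrite /jac lie0l lie0r lie0r lie0l lie0r !addr0.
Qed.

Let lieU2 g g' a b :
  w22_lie << g >> (a *: << g' >> + b *: Cg) = a *: w22_bracket g g'.
Proof.
have lieUC : w22_lie << g >> Cg = 0 by rewrite w22_lieU; case: g.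
have lieUZ d x : w22_lie << g >> (d *: x) = d *: w22_lie << g >> x.
  by rewrite -[d *: x]addr0 w22_lieDZr (w22_lieC 0) lie0l oppr0 addr0.
by rewrite w22_lieDZr lieUZ lieUC scaler0 addr0 w22_lieU.
Qed.

Let lieU0 g : w22_lie << g >> 0 = 0.
Proof. by rewrite w22_lieC lie0l oppr0. Qed.

Let jac_core (X : int -> w22) n m k :
  let B i j := (i - j)%:~R *: X (i + j) + w22_cocycle i j *: Cg in
  (m - k)%:~R *: B n (m + k) + (k - n)%:~R *: B m (k + n)
    + (n - m)%:~R *: B k (n + m) = 0.
Proof.
move=> B.
pose d (i j l : int) : K := (j - l)%:~R * (i - (j + l))%:~R.
pose e (i j l : int) : K := (j - l)%:~R * w22_cocycle i (j + l).
have BE i j l : (j - l)%:~R *: B i (j + l) =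
    d i j l *: X (i + (j + l)) + e i j l *: Cg.
  by rewrite /B scalerDr !scalerA.
rewrite !{}BE.
have -> : m + (k + n) = n + (m + k) by ring.
have -> : k + (n + m) = n + (m + k) by ring.
rewrite add3_comb.
have -> : d n m k + d m k n + d k n m = 0.
  rewrite /d -!rmorphM -!rmorphD /=.
  set z := (X in X%:~R); suff -> : z = 0 by []; rewrite /z; ring.
suff -> : e n m k + e m k n + e k n m = 0 by rewrite !scale0r addr0.
rewrite /e /w22_cocycle.
have -> : (n == - (m + k)) = (n + m + k == 0) by rewrite -addr_eq0 addrA.
have -> : (m == - (k + n)) = (n + m + k == 0).
  by rewrite -addr_eq0 addrA addrC addrA.
have -> : (k == - (n + m)) = (n + m + k == 0) by rewrite -addr_eq0 addrC.
case: eqP => [/eqP|_]; last by rewrite !mulr0 !addr0.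
rewrite addrC addr_eq0 => /eqP ->.
rewrite !mulrA -!rmorphM -!mulrDl -!rmorphD /=.
set z := (X in X%:~R); suff -> : z = 0 by rewrite mul0r.
rewrite /z; ring.
Qed.

Let jac_gen g1 g2 g3 : jac << g1 >> << g2 >> << g3 >> = 0.
Proof.
rewrite /jac !w22_lieU.
case: g1 g2 g3 => [n|n|] [m|m|] [k|k|] /=;
  rewrite ?lieU2 ?lieU0 /= ?scaler0 ?addr0 ?add0r //;
  exact: jac_core.
Qed.

Fact w22_jacobi x y z :
  w22_lie x (w22_lie y z) + w22_lie y (w22_lie z x) + w22_lie z (w22_lie x y)
  = 0.
Proof.
rewrite -/(jac x y z); elim/w22_ind: x => [|a g1 x IH]; first exact: jac0.
rewrite jacDZ {}IH addr0 jacC; clear x.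
elim/w22_ind: y => [|b g2 y IH]; first by rewrite jac0 scaler0.
rewrite jacDZ scalerDr {}IH addr0 jacC; clear y.
elim/w22_ind: z => [|c g3 z IH]; first by rewrite jac0 !scaler0.
by rewrite jacDZ scalerDr scalerDr {}IH addr0 jacC jac_gen !scaler0.
Qed.

HB.instance Definition _ := Lmodule_isLie.Build K w22
  w22_lieDZl w22_lieDZr w22_liexx w22_jacobi.

End W22.

Section W22Modules.
Variable K : fieldType.
Local Notation U := (uea (w22 K)).

Definition uL (n : int) : U := uea_in (Lg K n).
Definition uW (n : int) : U := uea_in (Wg K n).
Definition uC : U := uea_in (Cg K).

(* The span of the L_n and W_n with n > 0, described by supports. *)
Definition w22_plus : set (w22 K) :=
  [set x | forall g, g \in msupp x ->
     match g with GL n | GW n => 0 < n | GC => false end].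

Section Singular.
Variable V : lmodType U.

Definition L0_eigenvector (a : K) (x : V) : Prop :=
  x != 0 /\ uL 0 *: x = (a%:A : U) *: x.

Definition singular (x : V) : Prop :=
  (exists a, L0_eigenvector a x)
  /\ forall y, w22_plus y -> uea_in y *: x = 0.

End Singular.

Section Verma.
Variables c h hW : K.

Definition verma_rel : set (U^o) :=
  [set x | exists2 n : int, 0 < n & x = uL n \/ x = uW n]
  `|` [set uC - c%:A; uL 0 - h%:A; uW 0 - hW%:A].

Definition verma : lmodType U := lquot verma_rel.

Definition verma_vac : verma := lquot_pi verma_rel (1 : U^o).

End Verma.

(* The exponents m_s >= ... >= m_1 >= 1, listed from left to right. *)
Definition ptn : Type := {s : seq nat | sorted geq s && (0%N \notin s)}.
HB.instance Definition _ := Choice.on ptn.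

Definition Wmon (s : ptn) : U := \prod_(m <- val s) uW (- m%:Z).
Definition Lmon (s : ptn) : U := \prod_(n <- val s) uL (- n%:Z).

Section PBW.
Variables c h hW : K.
Local Notation V := (verma c h hW).
Local Notation v := (verma_vac c h hW).

Definition pbw (i : ptn * ptn) : V := (Wmon i.1 * Lmon i.2) *: v.

Definition Wdeg (i : ptn * ptn) : nat := size (val i.1).

Definition Wspan : set V := range (lincomb (fun s : ptn => Wmon s *: v)).

Definition Wcomp (d : nat) (f : {malg K[(ptn * ptn)%type]}) : V :=
  \sum_(i <- msupp f | Wdeg i == d) ((f@_i)%:A : U) *: pbw i.

(* The graph of the partial function sending x to its lowest nonzero
   homogeneous component y with respect to the W-degree, for some expansion f
   of x in the PBW vectors (unique, these being a basis). *)
Definition lowest_component (x y : V) : Prop :=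
  exists (f : {malg K[(ptn * ptn)%type]}) (d : nat),
    [/\ x = lincomb pbw f,
        forall d', (d' < d)%N -> Wcomp d' f = 0,
        Wcomp d f = y
      & y != 0].

(* The submodule generated by u' is U *: u'. *)
Definition Jquot (u' : V) : lmodType U := lquot [set u'].

Definition subsingular (u' u : V) : Prop :=
  (exists a, L0_eigenvector a u)
  /\ singular (lquot_pi [set u'] u : Jquot u').

End PBW.

End W22Modules.

(* Main.v *)
Require Import Defs.
From HB Require Import structures.
From mathcomp Require Import all_boot all_order all_algebra.
From mathcomp Require Import finmap boolp classical_sets fsbigop reals complex.
From mathcomp Require Import monalg.
From mathcomp Require Import ring zify.

(** The theorem is read off from a free field realization. Let [F] be the
    polynomial algebra in variables [a_{-k}], [b_{-k}] with [k > 0], on which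
    [a_{-k}], [b_{-k}] act by multiplication, [a_0], [b_0] by scalars, and
    [a_k], [b_k] by [k d/db_{-k}], [k d/da_{-k}]. With scalars [x], [y], put
    [L_n = sum_k :a_k b_{n-k}: - (n+1) (x b_n + y a_n)] and
    [W_n = 1/2 sum_k a_k a_{n-k} - (n+1) x a_n]. The [L_n] satisfy the Virasoro
    relations with central charge [2 - 24xy] ([vir_vir]), and [L_n], [W_m] those
    of W(2,2) with central term [- x^2 (n^3 - n)] ([vir_quad]). So when
    [12 x^2 = - c] and [2 - 24 x y = c], the universal property of the Verma
    module ([verma_hom]) gives an equivariant map [Phi] to [F] once [a_0], [b_0]
    are fitted to [hW] and [h]. The hypothesis on [p] says that [a_0] can be
    taken to be [x (p+1)]. Then the part of [L_n] that differentiates in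
    [a_{-n}] has the factor [a_0 - x (n+1) = x (p-n)], which vanishes exactly for
    [n = p], whereas every [L_{-m} v] has a nonzero term in [b_{-m}].

    Only two degrees in [a] matter. The operators [W_{-m}] multiply by [a]'s,
    so [Phi u] agrees with [L_{-p}^r 1] on the monomials free of [a]; and the
    submodule generated by [u'] is sent into the ideal [(a)], because [Phi u'] has
    no constant term, for reasons of weight, and a singular vector generates its
    submodule through the negative modes alone ([neg_span_stable]). Hence
    [L_n (Phi u)] vanishes modulo [(a)] for [n > 0]. For [n < p] these equations
    determine, by recursion on [n], the part of [Phi u] that is linear in
    [a_{-n}]; only one of its monomials of highest degree in [b] matters
    ([fcoef_a_next]). The equation for [n = p], where the unknown drops out, is
    then a relation between [h], [hW], [p] and [r] ([obstruction]), which is the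
    claimed formula.

    For [c = 0] one has [x = 0] and this collapses; moreover [hW = 0]. Instead,
    take [x = 1], [y = 1/12], so that the [L_n] have central charge 0, and let
    [W_n] act on [F + F] by sending the first copy to the second by the
    combination of [1/2 aa] and [1/2 bb] currents whose anomaly cancels. There
    [L_{p-1} W_{-p} v = (2p-1) W_{-1} v] is not 0, so [u'] can only exist for
    [p = 1] ([no_singular_W_vector]). For [p = 1] the first copy, a quotient
    where all [W_n] are 0, turns the question into
    [L_1 L_{-1}^r v = r (2h + r - 1) L_{-1}^{r-1} v]. *)

Set Implicit Arguments.
Unset Strict Implicit.
Unset Printing Implicit Defensive.

Import Order.TTheory GRing.Theory Num.Theory.
Local Open Scope ring_scope.

(** * Linear extension and finitely supported sums over the integers *)

Section LinearExtension.
Variables (K : fieldType) (I : choiceType) (V : lmodType K).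

Lemma malg_ind (P : {malg K[I]} -> Prop) :
    P 0 -> (forall a g x, P x -> P (a *: (<< g >> : {malg K[I]}) + x)) ->
  forall x, P x.
Proof.
move=> P0 PD x; rewrite [x]monalgE; elim/big_rec: _ => // g y _ Py.
have -> : << x@_g *g g >> = x@_g *: (<< g >> : {malg K[I]}).
  by apply/malgP => k; rewrite mcoeffZ !mcoeffU mulrnAr mulr1.
exact: PD.
Qed.

Definition malg_ext (F : I -> V) (x : {malg K[I]}) : V :=
  \sum_(g <- msupp x) x@_g *: F g.

Lemma malg_extEw (F : I -> V) (d : {fset I}) x : (msupp x `<=` d)%fset ->
  malg_ext F x = \sum_(g <- d) x@_g *: F g.
Proof.
move=> xd; apply: big_fset_incl => // g _ /mcoeff_outdom ->.
by rewrite scale0r.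
Qed.

Lemma malg_extU F g : malg_ext F << g >> = F g.
Proof.
by rewrite /malg_ext msuppU oner_eq0 big_seq_fset1 mcoeffUU scale1r.
Qed.

Fact malg_ext_is_linear F : linear (malg_ext F).
Proof.
move=> a x y.
pose d := (msupp x `|` msupp y `|` msupp (a *: x + y))%fset.
rewrite !(@malg_extEw F d); last 3 first.
- by apply/fsubsetP => g gx; rewrite !inE gx ?orbT.
- by apply/fsubsetP => g gx; rewrite !inE gx ?orbT.
- by apply/fsubsetP => g gx; rewrite !inE gx ?orbT.
rewrite scaler_sumr -big_split /=.
by apply: eq_bigr => g _; rewrite mcoeffD mcoeffZ scalerDl scalerA.
Qed.

HB.instance Definition _ F :=
  GRing.isLinear.Build K {malg K[I]} V _ (malg_ext F) (malg_ext_is_linear F).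

End LinearExtension.

Section IntegerSums.
Variable V : zmodType.
Implicit Types F G : int -> V.

Definition zsum F : V := \sum_(k \in [set: int]) F k.

(** At a family with infinite support [zsum] is 0 by convention, so additivity
    and linearity need this condition. *)
Definition zfin F := exists N : nat, forall k : int, (N < `|k|)%N -> F k = 0.

Definition zrange (N : nat) : seq int :=
  [seq i%:Z - N%:Z | i <- iota 0 (N + N).+1].

Lemma zrange_uniq N : uniq (zrange N).
Proof. by rewrite map_inj_uniq ?iota_uniq // => i j /addIr []. Qed.

Lemma mem_zrange N k : (k \in zrange N) = (`|k| <= N)%N.
Proof.
apply/mapP/idP => [ [n]|kN]; first by rewrite mem_iota => nN ->; lia.
exists (absz (k + N%:Z)); last by lia.
by rewrite mem_iota; lia.
Qed.

Lemma zsumE F (r : seq int) : uniq r -> (forall k, k \notin r -> F k = 0) ->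
  zsum F = \sum_(k <- r) F k.
Proof.
move=> ur rF; rewrite /zsum (fsbigE r) //; last by move=> i _; exact: rF.
by apply: eq_bigl => i; rewrite in_setT.
Qed.

Lemma zsum_range F N : (forall k : int, (N < `|k|)%N -> F k = 0) ->
  forall N', (N <= N')%N -> zsum F = \sum_(k <- zrange N') F k.
Proof.
move=> FN N' NN'; apply: zsumE (zrange_uniq _) _ => k.
rewrite mem_zrange -ltnNge => kN.
by apply: FN; apply: leq_ltn_trans kN.
Qed.

Lemma eq_zsum F G : F =1 G -> zsum F = zsum G.
Proof. by move=> /funext ->. Qed.

Lemma zsumD F G : zfin F -> zfin G ->
  zsum (fun k => F k + G k) = zsum F + zsum G.
Proof.
move=> [N FN] [N' GN]; have FGN k : (N + N' < `|k|)%N -> F k + G k = 0.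
  by move=> kN; rewrite FN ?GN ?addr0 //; lia.
rewrite (zsum_range FGN (leqnn _)) (zsum_range FN (leq_addr N' N)).
by rewrite (zsum_range GN (leq_addl N N')) big_split.
Qed.

Lemma zsum_shift F n : zsum (fun k => F (k + n)) = zsum F.
Proof.
rewrite /zsum [RHS](reindex_fsbigT (fun k : int => k + n)) //.
by exists (fun k => k - n) => k; rewrite ?addrK ?subrK.
Qed.

Lemma zsum1 F k0 : (forall k, k != k0 -> F k = 0) -> zsum F = F k0.
Proof.
move=> Fk; rewrite (@zsumE F [:: k0]) ?big_seq1 // => k.
by rewrite inE => /Fk.
Qed.

Lemma zsum0 F : (forall k, F k = 0) -> zsum F = 0.
Proof. by move=> F0; rewrite (@zsumE F [::]) ?big_nil. Qed.

Lemma zfinD F G : zfin F -> zfin G -> zfin (fun k => F k + G k).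
Proof.
move=> [N FN] [N' GN]; exists (N + N')%N => k kN.
by rewrite FN ?GN ?addr0 //; lia.
Qed.

Lemma zfin_shift F n : zfin F -> zfin (fun k => F (k + n)).
Proof. by move=> [N FN]; exists (N + `|n|)%N => k kN; apply: FN; lia. Qed.

Lemma zfin1 F k0 : (forall k, k != k0 -> F k = 0) -> zfin F.
Proof.
by move=> Fk; exists `|k0|%N => k kN; apply: Fk; apply: contraTneq kN => ->; lia.
Qed.

End IntegerSums.

Section IntegerSumsLinear.
Variables (K : fieldType) (V W : lmodType K).
Implicit Types F : int -> V.

Lemma linear_zsum (T : {linear V -> W}) F : zfin F ->
  T (zsum F) = zsum (fun k => T (F k)).
Proof.
move=> [N FN]; have TFN k : (N < `|k|)%N -> T (F k) = 0.
  by move=> kN; rewrite FN ?raddf0.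
by rewrite (zsum_range FN (leqnn _)) (zsum_range TFN (leqnn _)) raddf_sum.
Qed.

Lemma zfin_linear (T : {linear V -> W}) F : zfin F -> zfin (fun k => T (F k)).
Proof. by move=> [N FN]; exists N => k kN; rewrite FN ?raddf0. Qed.

Lemma zsumZ a F : zfin F -> zsum (fun k => a *: F k) = a *: zsum F.
Proof.
move=> [N FN]; have TFN k : (N < `|k|)%N -> a *: F k = 0.
  by move=> kN; rewrite FN ?scaler0.
by rewrite (zsum_range FN (leqnn _)) (zsum_range TFN (leqnn _)) scaler_sumr.
Qed.

Lemma zfinZ (a : int -> K) F : zfin F -> zfin (fun k => a k *: F k).
Proof. by move=> [N FN]; exists N => k kN; rewrite FN ?scaler0. Qed.

End IntegerSumsLinear.

(** * Fock space *)

Local Notation "x ** y" := (@mmul _ x y) (at level 40, left associativity).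
Local Notation "'U_(' i )" := (@ucm _ i).

Section Monomials.
Variable I : choiceType.
Implicit Types (m e : {cmonom I}) (i : I).

Lemma divcmK m i : (0 < m i)%N -> divcm m U_(i) ** U_(i) = m.
Proof.
move=> mi; apply/eqP/cmP => j; rewrite cmM divcmE cmU.
by case: eqP => [<-|_]; rewrite ?subnK ?subn0 ?addn0.
Qed.

Lemma mulcmK m i : divcm (m ** U_(i)) U_(i) = m.
Proof. by apply/eqP/cmP => j; rewrite divcmE cmM addnK. Qed.

Lemma mulcmAC m i j : m ** U_(i) ** U_(j) = m ** U_(j) ** U_(i).
Proof. by rewrite -!mulmA (mulmC U_(i)). Qed.

Lemma cm_case m i : m i = 0%N \/ exists e, m = e ** U_(i).
Proof.
have [|mi] := posnP (m i); [by left | right].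
by exists (divcm m U_(i)); rewrite divcmK.
Qed.

Lemma mulcmI i m e : m ** U_(i) = e ** U_(i) -> m = e.
Proof. by move=> /(congr1 (fun d => divcm d U_(i))); rewrite !mulcmK. Qed.

End Monomials.

(** Polynomials in variables indexed by [(s, k)]: [(true, k)] stands for
    [a_{-(k+1)}] and [(false, k)] for [b_{-(k+1)}]. Everything below is deduced
    from the effect of multiplication and derivation on the coefficients of
    monomials, so the polynomials themselves stay abstract. *)
Record fock_space (K : numFieldType) := FockSpace {
  fock :> lmodType K;
  fcoef : {cmonom (bool * nat)%type} -> fock -> K;
  mulvar : bool * nat -> fock -> fock;
  dervar : bool * nat -> fock -> fock;
  vac : fock;
  fcoefP : forall e a f g, fcoef e (a *: f + g) = a * fcoef e f + fcoef e g;
  fcoef_inj : forall f g, (forall e, fcoef e f = fcoef e g) -> f = g;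
  fcoef_mulvar : forall i e f, fcoef (e ** U_(i)) (mulvar i f) = fcoef e f;
  fcoef_mulvar0 : forall i (e : {cmonom (bool * nat)%type}) f,
    e i = 0%N -> fcoef e (mulvar i f) = 0;
  fcoef_dervar : forall i (e : {cmonom (bool * nat)%type}) f,
    fcoef e (dervar i f) = (e i).+1%:R * fcoef (e ** U_(i)) f;
  fcoef_vac : forall e, fcoef e vac = (e == @mone _)%:R;
  dervar_fin : forall f, exists N, forall s k, (N <= k)%N -> dervar (s, k) f = 0
}.

Lemma polynomial_fock_space (K : numFieldType) : fock_space K.
Proof.
pose mon : choiceType := {cmonom (bool * nat)%type}.
pose F : lmodType K := {malg K[mon]}.
pose X (i : bool * nat) : F -> F := malg_ext (fun m : mon => << m ** U_(i) >> : F).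
pose D (i : bool * nat) : F -> F :=
  malg_ext (fun m : mon => (m i)%:R *: (<< divcm m U_(i) >> : F)).
pose c (e : mon) (f : F) : K := f@_e.
have cP e a f g : c e (a *: f + g) = a * c e f + c e g.
  by rewrite /c mcoeffD mcoeffZ.
have XP i a f g : X i (a *: f + g) = a *: X i f + X i g.
  exact: malg_ext_is_linear.
have DP i a f g : D i (a *: f + g) = a *: D i f + D i g.
  exact: malg_ext_is_linear.
have X0 i : X i 0 = 0 by exact: (raddf0 (malg_ext _)).
have D0 i : D i 0 = 0 by exact: (raddf0 (malg_ext _)).
pose u (m : mon) : F := << m >>.
have cU e m : c e (u m) = (m == e)%:R by rewrite /c mcoeffU1.
have c0 e : c e 0 = 0 by exact: mcoeff0.
have XU i m : X i (u m) = u (m ** U_(i)) by exact: malg_extU.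
have DU i m : D i (u m) = (m i)%:R *: u (divcm m U_(i)) by exact: malg_extU.
have ind (P : F -> Prop) : P 0 -> (forall a m f, P f -> P (a *: u m + f)) ->
    forall f, P f by exact: malg_ind.
have cinj f g : (forall e, c e f = c e g) -> f = g by move=> fg; apply/malgP.
have cZ e a f : c e (a *: f) = a * c e f.
  by rewrite -[a *: f]addr0 cP c0 addr0.
have cvac e : c e (u (@mone _)) = (e == @mone _)%:R by rewrite cU eq_sym.
(* From here on only the listed properties of the operators are used. *)
move: F X D c u cP XP DP X0 D0 cU c0 XU DU ind cinj cZ cvac.
move=> F X D c u cP XP DP X0 D0 cU c0 XU DU ind cinj cZ cvac.
apply: (@FockSpace K F c X D (u (@mone _))) => //.
- move=> i e f; elim/ind: f => [|a m f IH]; first by rewrite X0 !c0.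
  rewrite XP !cP IH XU !cU; congr (_ * _%:R + _); congr nat_of_bool.
  by apply/eqP/eqP => [/mulcmI|->].
- move=> i e f ei; elim/ind: f => [|a m f IH]; first by rewrite X0 !c0.
  rewrite XP !cP IH XU !cU.
  case: eqP => [me|]; last by rewrite mulr0 addr0.
  by move: ei; rewrite -me cmM cmUU addn1.
- move=> i e f; elim/ind: f => [|a m f IH]; first by rewrite D0 !c0 mulr0.
  rewrite DP !cP IH DU cZ !cU mulrDr; congr (_ + _); rewrite [in RHS]mulrCA.
  congr (_ * _); have [mi|[e' ->]] := cm_case m i.
    have -> : (m == e ** U_(i)) = false.
      by apply/negP => /eqP me; move: mi; rewrite me cmM cmUU addn1.
    by rewrite mi mul0r mulr0.
  rewrite mulcmK cmM cmUU addn1.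
  have -> : (e' ** U_(i) == e ** U_(i)) = (e' == e).
    by apply/eqP/eqP => [/mulcmI|->].
  by case: eqP => [->|_]; rewrite ?mulr0.
- move=> f; elim/ind: f => [|a m f [N fN]].
    by exists 0%N => s k _; rewrite D0.
  exists (maxn N (\max_(i <- finsupp m) i.2).+1) => s k; rewrite geq_max.
  case/andP => Nk mk; rewrite DP fN // addr0 DU.
  have -> : m (s, k) = 0%N.
    apply/eqP; rewrite cmE_eq0; apply: contraTN mk => mk; rewrite -leqNgt.
    exact: (@leq_bigmax_seq _ _ xpredT (fun i : bool * nat => i.2) (s, k)).
  by rewrite scale0r scaler0.
Qed.

Section Oscillators.
Variables (K : numFieldType) (F : fock_space K).
Local Notation mon := {cmonom (bool * nat)%type}.
Implicit Types (f g : F) (e : mon) (i j : bool * nat).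

Lemma fcoef0 e : fcoef e (0 : F) = 0.
Proof.
have := fcoefP e 1 (0 : F) 0; rewrite scale1r addr0 mul1r => /eqP.
by rewrite -subr_eq subrr => /eqP.
Qed.

Lemma fcoefD e f g : fcoef e (f + g) = fcoef e f + fcoef e g.
Proof. by have := fcoefP e 1 f g; rewrite scale1r mul1r. Qed.

Lemma fcoefZ e a f : fcoef e (a *: f) = a * fcoef e f.
Proof. by rewrite -[a *: f]addr0 fcoefP fcoef0 addr0. Qed.

Lemma fcoefN e f : fcoef e (- f) = - fcoef e f.
Proof. by rewrite -scaleN1r fcoefZ mulN1r. Qed.

Fact fcoef_is_linear e : linear (fcoef e : F -> K^o).
Proof. exact: fcoefP. Qed.

HB.instance Definition _ e :=
  GRing.isLinear.Build K F K^o _ (@fcoef K F e : F -> K^o) (fcoef_is_linear e).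

Lemma mulvarP i a f g : mulvar i (a *: f + g) = a *: mulvar i f + mulvar i g.
Proof.
apply: fcoef_inj => e; rewrite fcoefP; have [ei|[m ->]] := cm_case e i.
  by rewrite !fcoef_mulvar0 // mulr0 addr0.
by rewrite !fcoef_mulvar fcoefP.
Qed.

Lemma dervarP i a f g : dervar i (a *: f + g) = a *: dervar i f + dervar i g.
Proof.
by apply: fcoef_inj => e; rewrite fcoefP !fcoef_dervar fcoefP mulrDr mulrCA.
Qed.

HB.instance Definition _ i :=
  GRing.isLinear.Build K F F _ (@mulvar K F i) (mulvarP i).
HB.instance Definition _ i :=
  GRing.isLinear.Build K F F _ (@dervar K F i) (dervarP i).

Lemma dervar_vac i : dervar i (vac F) = 0.
Proof.
apply: fcoef_inj => e; rewrite fcoef_dervar fcoef_vac fcoef0.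
by rewrite cmM_eq1 cm1_eq1 andbF mulr0.
Qed.

Lemma mulvarC i j f : mulvar i (mulvar j f) = mulvar j (mulvar i f).
Proof.
have [-> //|ij] := eqVneq i j; apply: fcoef_inj => e.
have [ei|[m ->]] := cm_case e i.
  rewrite fcoef_mulvar0 //; have [ej|[m em]] := cm_case e j.
    by rewrite fcoef_mulvar0.
  rewrite em fcoef_mulvar fcoef_mulvar0 //.
  by move: ei; rewrite em cmM cmU; lia.
rewrite fcoef_mulvar; have [mj|[n ->]] := cm_case m j.
  by rewrite !fcoef_mulvar0 // cmM cmU (negPf ij) mj.
by rewrite mulcmAC !fcoef_mulvar.
Qed.

Lemma dervarC i j f : dervar i (dervar j f) = dervar j (dervar i f).
Proof.
apply: fcoef_inj => e; rewrite !fcoef_dervar !cmM !cmU mulcmAC !mulrA.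
by congr (_ * _); case: (eqVneq i j) => [->|ij]; rewrite ?eqxx // !addn0 mulrC.
Qed.

Lemma dervar_mulvar i j f :
  dervar i (mulvar j f) = mulvar j (dervar i f) + (i == j)%:R *: f.
Proof.
apply: fcoef_inj => e; rewrite fcoefD fcoefZ fcoef_dervar.
have [<-|ij] := eqVneq i j.
  rewrite fcoef_mulvar mul1r; have [ei|[m ->]] := cm_case e i.
    by rewrite fcoef_mulvar0 // ei mul1r add0r.
  by rewrite fcoef_mulvar fcoef_dervar cmM cmUU addn1 -[X in _ + X]mul1r -mulrDl natr1.
rewrite mul0r addr0; have [ej|[m ->]] := cm_case e j.
  by rewrite !fcoef_mulvar0 ?mulr0 // cmM cmU (negPf ij) ej.
by rewrite mulcmAC !fcoef_mulvar fcoef_dervar cmM cmU eq_sym (negPf ij) addn0.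
Qed.

End Oscillators.

(** * Free field operators and their commutators *)

(** Reduces an identity between vectors to a scalar identity between their
    coefficients, which [ring] and [field] can decide. *)
Ltac to_coefs := apply: fcoef_inj => ?; rewrite ?(fcoefD, fcoefZ, fcoefN);
  repeat match goal with
    |- context [@fcoef ?K ?F ?e ?x] =>
      let y := fresh "y" in set y := (@fcoef K F e x); move: y => y end.

Ltac gen_ifs := repeat (move: (if _ then _ else _) => ?).

(** The modes of two conjugate bosonic fields, [a] for [true] and [b] for [false]:
    a positive mode of one is a derivation in the variables of the other. The
    scalar [z s] is the zero mode. *)
HB.lock Definition osc (K : numFieldType) (F : fock_space K) (z : bool -> K)
    (s : bool) (n : int) (f : F) : F :=
  match n with
  | Negz k => mulvar (s, k) f
  | Posz 0 => z s *: f
  | Posz k.+1 => k.+1%:R *: dervar (~~ s, k) f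
  end.

Section FockSpace.
Variables (K : numFieldType) (F : fock_space K) (z al : bool -> K).
Local Notation mon := {cmonom (bool * nat)%type}.
Implicit Types (f g : F) (e : mon) (s t : bool).

Local Notation osc := (@osc K F z).

Lemma oscN s k f : osc s (Negz k) f = mulvar (s, k) f.
Proof. by rewrite osc.unlock. Qed.

Lemma osc0 s f : osc s 0 f = z s *: f.
Proof. by rewrite osc.unlock. Qed.

Lemma oscS s k f : osc s k.+1%:Z f = k.+1%:R *: dervar (~~ s, k) f.
Proof. by rewrite osc.unlock. Qed.

Fact osc_is_linear s n : linear (osc s n).
Proof.
move=> a f g; case: n => [[|k]|k]; rewrite ?oscN ?osc0 ?oscS ?linearP //.
Qed.

HB.instance Definition _ s n :=
  GRing.isLinear.Build K F F _ (osc s n) (@osc_is_linear s n).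

Lemma oscP s n a f g : osc s n (a *: f + g) = a *: osc s n f + osc s n g.
Proof. exact: linearP. Qed.

Lemma oscZ s n a f : osc s n (a *: f) = a *: osc s n f.
Proof. exact: linearZ. Qed.

Lemma oscD s n f g : osc s n (f + g) = osc s n f + osc s n g.
Proof. exact: raddfD. Qed.

Lemma oscB s n f g : osc s n (f - g) = osc s n f - osc s n g.
Proof. exact: raddfB. Qed.

Lemma oscC s t n m f : osc s n (osc t m f) =
  osc t m (osc s n f)
  + (if (s != t) && (n + m == 0) then n%:~R else 0) *: f.
Proof.
case: n m => [[|n]|n] [[|m]|m];
  rewrite ?oscN ?osc0 ?oscS ?linearZ /= ?oscN ?osc0 ?oscS.
- by rewrite !scalerA mulrC if_same scale0r addr0.
- by rewrite !scalerA mulrC andbF scale0r addr0.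
- by rewrite andbF scale0r addr0.
- by rewrite !scalerA mulrC andbF scale0r addr0.
- by rewrite !scalerA mulrC dervarC andbF scale0r addr0.
- rewrite dervar_mulvar scalerDr !scalerA.
  have -> : ((~~ s, n) == (t, m)) = (s != t) && (n.+1%:Z + Negz m == 0).
    by rewrite xpair_eqE; congr (_ && _); [case: s t => [] [] | lia].
  by case: ifP; rewrite ?mulr1 ?mulr0.
- by rewrite andbF scale0r addr0.
- rewrite dervar_mulvar scalerDr scalerA.
  have -> : ((~~ t, m) == (s, n)) = (s != t) && (Negz n + m.+1%:Z == 0).
    by rewrite xpair_eqE; congr (_ && _); [case: s t => [] [] | lia].
  case: ifP => [/andP[_ /eqP nm]|_]; last by rewrite mulr0 !scale0r !addr0.
  have -> : Negz n = - m.+1%:Z by lia.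
  by rewrite rmorphN mulr1 scaleNr addrK.
- by rewrite mulvarC andbF scale0r addr0.
Qed.

Lemma oscCs s n m f : osc s n (osc s m f) = osc s m (osc s n f).
Proof. by rewrite oscC eqxx scale0r addr0. Qed.

Lemma osc_fin f : exists N : nat, forall s (n : int), N%:Z < n -> osc s n f = 0.
Proof.
have [N fN] := dervar_fin f; exists N => s [[|n]|n] Nn; [lia| |lia].
by rewrite oscS fN ?scaler0 //; lia.
Qed.

(** A mode [a_k] with [k > 0] acts before [b_l], any other one after it, so that
    on a given vector only finitely many of the products with [k + l] fixed are
    nonzero. *)
Definition nord (k l : int) f : F :=
  if 0 < k then osc false l (osc true k f) else osc true k (osc false l f).

Fact nord_is_linear k l : linear (nord k l).
Proof. by move=> a f g; rewrite /nord; case: ifP; rewrite !linearP. Qed.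

HB.instance Definition _ k l :=
  GRing.isLinear.Build K F F _ (nord k l) (@nord_is_linear k l).

Lemma nord_zfin n f : zfin (fun k => nord k (n - k) f).
Proof.
have [N fN] := osc_fin f; exists (N + `|n|)%N => k kN; rewrite /nord.
case: ifP => k0; first by rewrite (fN _ k) ?raddf0 //; lia.
by rewrite (fN _ (n - k)) ?raddf0 //; lia.
Qed.

Lemma nord_osc k l s j f : nord k l (osc s j f) = osc s j (nord k l f) +
  (if s then (if l + j == 0 then l%:~R else 0) *: osc true k f
   else (if k + j == 0 then k%:~R else 0) *: osc false l f).
Proof.
rewrite /nord; case: s => /=; case: ifP => _.
- by rewrite (oscCs true k j) (oscC false true l j).
- by rewrite (oscC false true l j) oscD oscZ (oscCs true k j).
- by rewrite (oscC true false k j) oscD oscZ (oscCs false l j).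
- by rewrite (oscCs false l j) (oscC true false k j).
Qed.

Lemma osc_nord_ba l j f : osc false l (osc true j f) =
  nord j l f + (if (0 < j) || (l + j != 0) then 0 else l%:~R) *: f.
Proof.
rewrite /nord; case: ifP => _ /=; first by rewrite scale0r addr0.
by rewrite oscC /=; case: eqP.
Qed.

Lemma osc_nord_ab l j f : osc true j (osc false l f) =
  nord j l f + (if (0 < j) && (j + l == 0) then j%:~R else 0) *: f.
Proof.
rewrite /nord; case: ifP => _ /=; last by rewrite scale0r addr0.
by rewrite oscC.
Qed.

End FockSpace.

(** The stress tensor [:ab:] with background charges: [al true] and [al false] are
    the anomalies that it gives to the fields [a] and [b]. *)
HB.lock Definition vir (K : numFieldType) (F : fock_space K)
    (z al : bool -> K) (n : int) (f : F) : F :=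
  zsum (fun k => nord z k (n - k) f)
  - (n + 1)%:~R *: (al true *: osc z false n f + al false *: osc z true n f).

(** The current [1/2 zz + al z'] of one of the two fields; no normal ordering is
    involved, because the modes of one field commute. *)
HB.lock Definition quad (K : numFieldType) (F : fock_space K)
    (z al : bool -> K) (s : bool) (m : int) (f : F) : F :=
  2^-1 *: zsum (fun k => osc z s k (osc z s (m - k) f))
  - (al s * (m + 1)%:~R) *: osc z s m f.

Section FockActions.
Variables (K : numFieldType) (F : fock_space K) (z al : bool -> K).
Local Notation mon := {cmonom (bool * nat)%type}.
Implicit Types (f g : F) (e : mon) (s t : bool).
Local Notation osc := (@osc K F z).
Local Notation nord := (@nord K F z).
Local Notation vir := (@vir K F z al).
Local Notation quad := (@quad K F z al).

Lemma virE n f : vir n f = zsum (fun k => nord k (n - k) f)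
  - (n + 1)%:~R *: (al true *: osc false n f + al false *: osc true n f).
Proof. by rewrite vir.unlock. Qed.

Lemma quadE s m f : quad s m f =
  2^-1 *: zsum (fun k => osc s k (osc s (m - k) f))
  - (al s * (m + 1)%:~R) *: osc s m f.
Proof. by rewrite quad.unlock. Qed.

Lemma osc2_zfin s (j : int) f : zfin (fun k => osc s k (osc s (j - k) f)).
Proof.
have [N fN] := osc_fin z f; exists (N + `|j|)%N => k kN.
have [k0|k0] := ltrP 0 k; last by rewrite (fN _ (j - k)) ?raddf0 //; lia.
by rewrite oscCs (fN _ k) ?raddf0 //; lia.
Qed.

Lemma zsum_linear (T : int -> F -> F) :
    (forall k, linear (T k)) -> (forall f, zfin (T^~ f)) ->
  linear (fun f => zsum (T^~ f)).
Proof.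
move=> Tlin Tfin a f g.
rewrite -zsumZ // -zsumD //; last exact: zfinZ.
by apply: eq_zsum => k; rewrite Tlin.
Qed.

Fact vir_is_linear n : linear (vir n).
Proof.
move=> a f g; rewrite !virE (@zsum_linear (fun k => nord k (n - k))); first last.
- exact: nord_zfin.
- by move=> k; exact: linearP.
rewrite !oscP; move: (zsum _) (zsum _) => A B.
move: (osc _ _ _) (osc _ _ _) (osc _ _ _) (osc _ _ _) => u v w x.
to_coefs; ring.
Qed.

HB.instance Definition _ n :=
  GRing.isLinear.Build K F F _ (vir n) (@vir_is_linear n).

Fact quad_is_linear s n : linear (quad s n).
Proof.
move=> a f g; rewrite !quadE.
rewrite (@zsum_linear (fun k g => osc s k (osc s (n - k) g))); first last.
- by move=> h; exact: osc2_zfin.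
- by move=> k b u v; rewrite !oscP.
rewrite !oscP; move: (zsum _) (zsum _) => A B.
move: (osc _ _ _) (osc _ _ _) => u v.
to_coefs; ring.
Qed.

HB.instance Definition _ s n :=
  GRing.isLinear.Build K F F _ (quad s n) (@quad_is_linear s n).

Lemma virP n a f g : vir n (a *: f + g) = a *: vir n f + vir n g.
Proof. exact: linearP. Qed.

Lemma virZ n a f : vir n (a *: f) = a *: vir n f.
Proof. exact: linearZ. Qed.

Lemma virD n f g : vir n (f + g) = vir n f + vir n g.
Proof. exact: raddfD. Qed.

Lemma virB n f g : vir n (f - g) = vir n f - vir n g.
Proof. exact: raddfB. Qed.

Lemma quadZ s n a f : quad s n (a *: f) = a *: quad s n f.
Proof. exact: linearZ. Qed.

Lemma quadB s n f g : quad s n (f - g) = quad s n f - quad s n g.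
Proof. exact: raddfB. Qed.

(** Each field has conformal weight one up to an anomaly proportional to its
    background charge. In the quadratic part at most one summand fails to
    commute with [osc s j]. *)
Lemma vir_osc n s j f : vir n (osc s j f) = osc s j (vir n f)
  - j%:~R *: osc s (n + j) f
  - (if n + j == 0 then al s * (n * (n + 1))%:~R else 0) *: f.
Proof.
rewrite !virE.
pose c k := if s then (if n - k + j == 0 then (n - k)%:~R else 0) *: osc true k f
   else (if k + j == 0 then k%:~R else 0) *: osc false (n - k) f.
have cfin1 : {k0 | forall k, k != k0 -> c k = 0 & c k0 = - j%:~R *: osc s (n + j) f}.
  rewrite /c; case: (s).
    exists (n + j) => [k kn|]; first by rewrite ifF ?scale0r //; lia.
    have -> : n - (n + j) = - j by ring.
    by rewrite addNr eqxx rmorphN.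
  exists (- j) => [k kn|]; first by rewrite ifF ?scale0r //; lia.
  by rewrite addNr eqxx rmorphN opprK.
have {cfin1} [k0 ck0 ck] := cfin1.
rewrite (eq_zsum (G := fun k => osc s j (nord k (n - k) f) + c k)); last first.
  by move=> k; rewrite nord_osc.
rewrite zsumD; last 2 first.
- exact/zfin_linear/nord_zfin.
- exact: zfin1 ck0.
rewrite -(linear_zsum (osc s j)); last exact: nord_zfin.
rewrite (zsum1 ck0) ck /= oscB !oscZ oscD !oscZ.
rewrite (oscC _ false s n j) (oscC _ true s n j).
to_coefs; rewrite !rmorphM !rmorphD /=; case: (s) => /=; case: eqP => _; ring.
Qed.

(** The central term comes from the anomaly alone: the modes of one field commute,
    so reindexing the sums is legitimate without reordering. *)
Lemma vir_quad n m s f : vir n (quad s m f) = quad s m (vir n f)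
  + (n - m)%:~R *: quad s (n + m) f
  - (if n + m == 0 then al s ^+ 2 * (n ^+ 3 - n)%:~R else 0) *: f.
Proof.
rewrite !quadE virB !virZ (linear_zsum (vir n)); last exact: osc2_zfin.
pose G k := osc s k (osc s (n + m - k) f).
have Gfin : zfin G by exact: osc2_zfin.
pose A := al s * (n * (n + 1))%:~R.
pose F1 k := osc s k (osc s (m - k) (vir n f)).
pose F2 k := (- (m - k)%:~R) *: G k.
pose F3 k := (if k == n + m then - A else 0) *: osc s k f.
pose F4 k := - k%:~R *: G (k + n).
pose F5 k := (if k == - n then - A else 0) *: osc s (m - k) f.
have FE k : vir n (osc s k (osc s (m - k) f)) = F1 k + F2 k + F3 k + F4 k + F5 k.
  rewrite vir_osc vir_osc !oscB !oscZ.
  rewrite /F1 /F2 /F3 /F4 /F5 /G.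
  have -> : n + (m - k) = n + m - k by ring.
  have -> : n + m - (k + n) = m - k by ring.
  have -> : (k == n + m) = (n + m - k == 0) by lia.
  have -> : (k == - n) = (n + k == 0) by lia.
  rewrite (addrC n k) -/A.
  move: (osc s _ _) (osc s _ _) (osc s _ _) (osc s _ _) (osc s _ _) => u1 u2 u3 u4 u5.
  to_coefs.
  by do 2! case: ifP => _; ring.
have F1fin : zfin F1 by exact: osc2_zfin.
have F2fin : zfin F2 by exact: zfinZ.
have F30 k : k != n + m -> F3 k = 0 by rewrite /F3 => /negPf ->; rewrite scale0r.
have F4fin : zfin F4 by apply: zfinZ; exact: zfin_shift.
have F50 k : k != - n -> F5 k = 0 by rewrite /F5 => /negPf ->; rewrite scale0r.
have F3fin := zfin1 F30; have F5fin := zfin1 F50.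
rewrite (eq_zsum FE) !zsumD //; do ?[exact: zfinD | apply: zfinD => //].
rewrite (zsum1 F30) (zsum1 F50) /F3 /F5 !eqxx opprK.
(* Shifting the index in one of the two sums makes them termwise proportional. *)
have F24 : zsum F2 + zsum F4 = (n - m)%:~R *: zsum G.
  rewrite -(zsum_shift F4 (- n)) -zsumZ // -zsumD //; last exact: zfin_shift.
  apply: eq_zsum => k; rewrite /F2 /F4 subrK -scalerDl; congr (_ *: _).
  by rewrite -!rmorphN -rmorphD /=; congr (_%:~R); ring.
have {F24} -> : zsum F4 = (n - m)%:~R *: zsum G - zsum F2 by rewrite -F24 addrC addKr.
rewrite vir_osc (addrC m n) /A -/G.
move: (zsum _) (zsum _) (zsum _) (osc s _ _) (osc s _ _) => u1 u2 u3 u4 u5.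
to_coefs.
case: eqP => [nm|_].
  have -> : m = - n by lia.
  by rewrite !(rmorphM, rmorphD, rmorphN, rmorphXn) /=; field.
by rewrite !(rmorphM, rmorphD, rmorphN, rmorphXn) /=; field.
Qed.

Lemma quad_osc s m j f : quad s m (osc s j f) = osc s j (quad s m f).
Proof.
rewrite !quadE oscB !oscZ oscCs (linear_zsum (osc s j)); last exact: osc2_zfin.
congr (_ *: _ - _); apply: eq_zsum => k.
by rewrite (oscCs _ _ _ j) (oscCs _ _ _ j).
Qed.

Lemma quadC s n m f : quad s n (quad s m f) = quad s m (quad s n f).
Proof.
rewrite [LHS]quadE (quadE s n f) quadB !quadZ quad_osc.
rewrite (linear_zsum (quad s m)); last exact: osc2_zfin.
congr (_ *: _ - _); apply: eq_zsum => k.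
by rewrite /= !quad_osc.
Qed.

(** Moving an annihilation operator past a creation operator produces this
    scalar; summed over [k] it gives the central term of the Virasoro
    bracket. *)
Definition ordering_defect (n k : int) : int :=
  if 0 < k then (if n + k <= 0 then - (k * (n + k)) else 0)
  else (if 0 < n + k then k * (n + k) else 0).

(** Commuting [L_n] with a normally ordered product gives products that are not
    normally ordered; reordering them produces the defect. *)
Lemma vir_nord n k l f : vir n (nord k l f) = nord k l (vir n f)
  - k%:~R *: nord (n + k) l f - l%:~R *: nord k (n + l) f
  - (if n + k == 0 then al true * (n * (n + 1))%:~R else 0) *: osc false l f
  - (if n + l == 0 then al false * (n * (n + 1))%:~R else 0) *: osc true k f
  - (if n + k + l == 0 then (ordering_defect n k)%:~R else 0) *: f.
Proof.
have nordE g : nord k l g = if 0 < k then osc false l (osc true k g)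
    else osc true k (osc false l g) by [].
rewrite (nordE f) (nordE (vir n f)); have [k0|k0] := ltrP 0 k.
- rewrite !vir_osc !oscB !oscZ.
  rewrite (osc_nord_ba z l (n + k) f) (osc_nord_ba z (n + l) k f) k0 /=.
  have <- : k%:~R * (if (0 < n + k) || (l + (n + k) != 0) then 0 else l%:~R)
      = (if n + k + l == 0 then (ordering_defect n k)%:~R else 0) :> K.
    have -> : (0 < n + k) = ~~ (n + k <= 0) by lia.
    rewrite /ordering_defect k0 (addrC l).
    case: eqP => [nkl|_]; last by rewrite orbT mulr0.
    case: (n + k <= 0) => /=; last by rewrite mulr0.
    have -> : l = - (n + k) by lia.
    by rewrite !(rmorphN, rmorphM) mulrN.
  by to_coefs; gen_ifs; ring.
- rewrite !vir_osc !oscB !oscZ.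
  rewrite (osc_nord_ab z l (n + k) f) (osc_nord_ab z (n + l) k f).
  have -> : (0 < k) = false by lia.
  have <- : k%:~R * (if (0 < n + k) && (n + k + l == 0) then (n + k)%:~R else 0)
      = (if n + k + l == 0 then (ordering_defect n k)%:~R else 0) :> K.
    rewrite /ordering_defect; have -> : (0 < k) = false by lia.
    case: eqP => [nkl|_]; last by rewrite andbF mulr0.
    by case: (0 < n + k); rewrite ?mulr0 //= rmorphM.
  by to_coefs; gen_ifs; ring.
Qed.

Lemma sum_ord_mul (N : nat) (x : K) :
  \sum_(i < N) i%:R * (x - i%:R)
  = N%:R * (N%:R - 1) / 2 * x - N%:R * (N%:R - 1) * (2 * N%:R - 1) / 6.
Proof.
elim: N => [|N IH]; first by rewrite big_ord0 !mul0r subrr.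
by rewrite big_ord_recr /= IH -natr1; field.
Qed.

Lemma ordering_defect_zfin n : zfin (fun k => (ordering_defect n k)%:~R : K).
Proof.
by exists `|n|%N => k kn; rewrite /ordering_defect; do 2! case: ifP => //; lia.
Qed.

Lemma zsum_ordering_defect n :
  zsum (fun k => (ordering_defect n k)%:~R : K) = - (n ^+ 3 - n)%:~R / 6.
Proof.
case: (intP n) => [|N|N].
- by rewrite zsum0 => [|k]; rewrite ?mul0r ?oppr0 ?mul0r // /ordering_defect;
    do 2! case: ifP => //; lia.
- rewrite (@zsumE _ _ [seq - i%:Z | i <- iota 0 N.+1]); first last.
  + move=> k kN; rewrite /ordering_defect; have [k0|k0] := ltrP 0 k.
      by rewrite ifF //; lia.
    rewrite ifF //; apply: contraNF kN => nk; apply/mapP.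
    by exists (absz k); rewrite ?mem_iota; lia.
  + by rewrite map_inj_uniq ?iota_uniq // => i j /oppr_inj [].
  rewrite big_map -/(index_iota 0 N.+1) big_mkord.
  under eq_bigr => i _.
    have -> : (ordering_defect N.+1%:Z (- i%:Z))%:~R
        = - (i%:R * (N.+1%:R - i%:R)) :> K.
      rewrite /ordering_defect ifF; last by lia.
      rewrite ifT; last by have := ltn_ord i; lia.
      by rewrite rmorphM rmorphD rmorphN /=; ring.
    over.
  by rewrite sumrN sum_ord_mul !(rmorphN, rmorphB, rmorphXn) /=; field.
(* The extreme terms [0] and [N.+1] of this range vanish. *)
- rewrite (@zsumE _ _ [seq i%:Z | i <- iota 0 N.+2]); first last.
  + move=> k kN; rewrite /ordering_defect; have [k0|k0] := ltrP 0 k.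
      rewrite ifF //; apply: contraNF kN => nk; apply/mapP.
      by exists (absz k); rewrite ?mem_iota; lia.
    by rewrite ifF //; lia.
  + by rewrite map_inj_uniq ?iota_uniq // => i j [].
  rewrite big_map -/(index_iota 0 N.+2) big_mkord.
  under eq_bigr => i _.
    have -> : (ordering_defect (- N.+1%:Z) i%:Z)%:~R = i%:R * (N.+1%:R - i%:R) :> K.
      have iN := ltn_ord i; rewrite /ordering_defect; case: ifP => i0.
        rewrite ifT; last by lia.
        by rewrite rmorphN rmorphM rmorphD rmorphN /=; ring.
      have -> : nat_of_ord i = 0%N by lia.
      by case: (_ < _); rewrite !mul0r.
    over.
  by rewrite sum_ord_mul !(rmorphN, rmorphB, rmorphXn) /=; field.
Qed.

(** The normal ordering contributes 2 to the central charge and the background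
    charges contribute [- 24 al al]. *)
Lemma vir_vir n m f : vir n (vir m f) = vir m (vir n f)
  + (n - m)%:~R *: vir (n + m) f
  + (if n + m == 0 then (n ^+ 3 - n)%:~R / 12 * (2 - 24 * al true * al false)
     else 0) *: f.
Proof.
rewrite (virE m f) (virE m (vir n f)) virB !virZ virD !virZ !vir_osc.
rewrite (linear_zsum (vir n)); last exact: nord_zfin.
pose G k := nord k (n + m - k) f; have Gfin : zfin G by exact: nord_zfin.
pose A := al true * (n * (n + 1))%:~R; pose B := al false * (n * (n + 1))%:~R.
pose F1 k := nord k (m - k) (vir n f).
pose F2 k := (- (m - k)%:~R) *: G k.
pose F3 k := (if k == - n then - A else 0) *: osc false (m - k) f.
pose F4 k := - k%:~R *: G (k + n).
pose F5 k := (if k == n + m then - B else 0) *: osc true k f.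
pose F6 k := (if n + m == 0 then - (ordering_defect n k)%:~R else 0) *: f.
have FE k : vir n (nord k (m - k) f) = F1 k + F2 k + F3 k + F4 k + F5 k + F6 k.
  rewrite vir_nord /F1 /F2 /F3 /F4 /F5 /F6 /G.
  have -> : n + (m - k) = n + m - k by ring.
  have -> : n + m - (k + n) = m - k by ring.
  have -> : n + k + (m - k) = n + m by ring.
  have -> : (k == n + m) = (n + m - k == 0) by lia.
  have -> : (k == - n) = (n + k == 0) by lia.
  rewrite (addrC n k) -/A -/B; to_coefs.
  by do 3! case: ifP => _; ring.
have F1fin : zfin F1 by exact: nord_zfin.
have F2fin : zfin F2 by exact: zfinZ.
have F30 k : k != - n -> F3 k = 0 by rewrite /F3 => /negPf ->; rewrite scale0r.
have F4fin : zfin F4 by apply: zfinZ; exact: zfin_shift.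
have F50 k : k != n + m -> F5 k = 0 by rewrite /F5 => /negPf ->; rewrite scale0r.
have F3fin := zfin1 F30; have F5fin := zfin1 F50.
have [N defN] := ordering_defect_zfin n.
have F6fin : zfin F6.
  by exists N => k /defN dk; rewrite /F6 dk oppr0 if_same scale0r.
rewrite (eq_zsum FE) !zsumD //; do ?[exact: zfinD | apply: zfinD => //].
rewrite (zsum1 F30) (zsum1 F50) /F3 /F5 !eqxx opprK.
have -> : zsum F6 = (if n + m == 0 then (n ^+ 3 - n)%:~R / 6 else 0) *: f.
  rewrite /F6; case: eqP => _; last by rewrite zsum0 ?scale0r // => k; rewrite scale0r.
  have := zsum_range defN (leqnn N); rewrite zsum_ordering_defect => sE.
  rewrite (@zsum_range _ _ N _ N) // => [|k /defN ->]; last by rewrite oppr0 scale0r.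
  by rewrite -scaler_suml sumrN -sE; congr (_ *: _); field.
(* Shifting the index in one of the two sums makes them termwise proportional. *)
have F24 : zsum F2 + zsum F4 = (n - m)%:~R *: zsum G.
  rewrite -(zsum_shift F4 (- n)) -zsumZ // -zsumD //; last exact: zfin_shift.
  apply: eq_zsum => k; rewrite /F2 /F4 subrK -scalerDl; congr (_ *: _).
  by rewrite -!rmorphN -rmorphD /=; congr (_%:~R); ring.
have {F24} -> : zsum F4 = (n - m)%:~R *: zsum G - zsum F2 by rewrite -F24 addrC addKr.
rewrite (virE (n + m) f) (addrC m n) /A /B /F1 /G; to_coefs.
case: eqP => [nm|_].
  have -> : m = - n by lia.
  by rewrite !(rmorphM, rmorphD, rmorphN, rmorphXn) /=; field.
by rewrite !(rmorphM, rmorphD, rmorphN, rmorphXn) /=; field.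
Qed.

End FockActions.

(** * Representations of the enveloping algebra *)

Section UeaAction.
Variables (K : fieldType) (L : lieAlgType K) (M : lmodType K).
Variable rho : L -> M -> M.
Hypothesis rhoPl : forall a y z x, rho (a *: y + z) x = a *: rho y x + rho z x.
Hypothesis rhoPr : forall y a x x', rho y (a *: x + x') = a *: rho y x + rho y x'.
Hypothesis rho_lie : forall y z x,
  rho (lie y z) x = rho y (rho z x) - rho z (rho y x).

Local Notation free_alg := {malg K[{fmonom L}]}.

Let rho0 y : rho y 0 = 0.
Proof.
have := rhoPr y 1 0 0; rewrite !scale1r addr0 => /eqP.
by rewrite -subr_eq subrr eq_sym => /eqP.
Qed.

Definition word_act (w : {fmonom L}) (x : M) : M := foldr rho x (w : seq L).

Definition free_act (x : M) : free_alg -> M := malg_ext (word_act^~ x).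

Lemma word_actP w a x x' :
  word_act w (a *: x + x') = a *: word_act w x + word_act w x'.
Proof. by rewrite /word_act; elim: (w : seq L) => //= y s ->. Qed.

Lemma free_actP x a f g : free_act x (a *: f + g) = a *: free_act x f + free_act x g.
Proof. exact: malg_ext_is_linear. Qed.

Lemma free_act0 x : free_act x 0 = 0.
Proof. exact: (raddf0 (malg_ext _)). Qed.

Lemma free_actD x f g : free_act x (f + g) = free_act x f + free_act x g.
Proof. exact: (raddfD (malg_ext _)). Qed.

Lemma free_actB x f g : free_act x (f - g) = free_act x f - free_act x g.
Proof. exact: (raddfB (malg_ext _)). Qed.

Lemma free_actU x w : free_act x << w >> = word_act w x.
Proof. exact: malg_extU. Qed.

Lemma free_act_linear f a x x' :
  free_act (a *: x + x') f = a *: free_act x f + free_act x' f.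
Proof.
elim/malg_ind: f => [|b w f IH]; first by rewrite !free_act0 scaler0 addr0.
rewrite !free_actP IH !free_actU word_actP !scalerDr !scalerA mulrC.
by rewrite addrACA.
Qed.

Lemma free_act0r f : free_act 0 f = 0.
Proof.
have := free_act_linear f 1 0 0; rewrite !scale1r addr0 => /eqP.
by rewrite -subr_eq subrr eq_sym => /eqP.
Qed.

Lemma malgZAr (w : {fmonom L}) b g :
  << w >> * (b *: g) = b *: (<< w >> * g) :> free_alg.
Proof.
have bw : << w >> * b%:MP = b%:MP * << w >> :> free_alg.
  by rewrite !malgM_def !fgmulUU mulm1 mul1m mul1r mulr1.
rewrite -(mul_malgC b g) -(mul_malgC b (<< w >> * g)).
by apply: etrans (mulrA _ _ _) _; rewrite bw; apply: esym (mulrA _ _ _).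
Qed.

Lemma free_actM x f g : free_act x (f * g) = free_act (free_act x g) f.
Proof.
elim/malg_ind: f => [|a w f IH]; first by rewrite mul0r !free_act0.
have -> : (a *: << w >> + f) * g = a *: (<< w >> * g) + f * g :> free_alg.
  exact: etrans (mulrDl _ _ _) (congr1 (+%R^~ _) (esym (fgscaleAl _ _ _))).
rewrite (free_actP x a (<< w >> * g)) (free_actP _ a << w >> f).
congr (_ *: _ + _); last exact: IH.
clear f IH; rewrite (free_actU _ w); elim/malg_ind: g => [|b w' g IH].
  by rewrite mulr0 !free_act0 -[RHS]free_actU free_act0r.
have -> : << w >> * (b *: << w' >> + g)
    = b *: (<< w >> * << w' >>) + << w >> * g :> free_alg.
  exact: etrans (mulrDr _ _ _) (congr1 (+%R^~ _) (malgZAr _ _ _)).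
rewrite (free_actP x b (<< w >> * << w' >>)) (free_actP x b << w' >> g).
rewrite word_actP; congr (_ *: _ + _); last exact: IH.
clear g IH.
have -> : << w >> * << w' >> = << (w ** w') >> :> free_alg.
  by rewrite malgM_def fgmulUU mulr1.
by rewrite !free_actU /word_act fmM foldr_cat.
Qed.

Lemma free_act_gen x y : free_act x (free_gen y) = rho y x.
Proof. by rewrite free_actU /word_act fmU. Qed.

(** Words in the Lie algebra act on [M] by composition; since [rho] is linear and
    compatible with brackets, the defining ideal of the enveloping algebra acts
    by zero, and the action descends. *)
Lemma free_act_ideal f : uea_ideal f -> forall x, free_act x f = 0.
Proof.
elim=> {f} [f Rf x|x|f g _ IHf _ IHg x|g f _ IH x|g f _ IH x].
- case: Rf => [a y z|y z].
    rewrite free_actB free_act_gen free_actP !free_act_gen.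
    by rewrite rhoPl subrr.
  have genM s t : free_act x (free_gen s * free_gen t) = rho s (rho t x).
    by apply: etrans (free_actM _ _ _) _; rewrite 2!free_act_gen.
  rewrite 2!free_actB free_act_gen rho_lie.
  by apply/eqP; rewrite subr_eq0; apply/eqP; congr (_ - _); exact: genM.
- exact: free_act0.
- by rewrite free_actD IHf IHg addr0.
- by rewrite free_actM IH free_act0r.
- by rewrite free_actM IH.
Qed.

Definition uea_act (q : uea L) (x : M) : M := free_act x (uea_repr q).

Lemma uea_act_pi f x : uea_act (uea_pi f) x = free_act x f.
Proof.
apply/eqP; rewrite -subr_eq0 -free_actB; apply/eqP; apply: free_act_ideal.
by apply/uea_piP; rewrite uea_reprK.
Qed.

Lemma uea_actP q a x x' :
  uea_act q (a *: x + x') = a *: uea_act q x + uea_act q x'.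
Proof. exact: free_act_linear. Qed.

Lemma uea_actD p q x : uea_act (p + q) x = uea_act p x + uea_act q x.
Proof.
by rewrite -(uea_reprK p) -(uea_reprK q) -uea_piD !uea_act_pi free_actD.
Qed.

Lemma uea_actM p q x : uea_act (p * q) x = uea_act p (uea_act q x).
Proof.
rewrite -(uea_reprK p) -(uea_reprK q) (uea_mul_pi _ _ : _ * _ = _).
by rewrite !uea_act_pi free_actM.
Qed.

Lemma uea_actZ a q x : uea_act (a *: q) x = a *: uea_act q x.
Proof.
rewrite -(uea_reprK q) (uea_scale_pi _ _ : _ *: _ = _) !uea_act_pi.
by rewrite -[a *: _ in LHS]addr0 free_actP free_act0 addr0.
Qed.

Lemma uea_act1 x : uea_act 1 x = x.
Proof.
rewrite (_ : 1 = uea_pi (1 : free_alg)) // uea_act_pi.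
by rewrite (_ : 1 = << @mone _ >>) // free_actU /word_act fm1.
Qed.

Lemma uea_act_in y x : uea_act (uea_in y) x = rho y x.
Proof. by rewrite uea_act_pi free_act_gen. Qed.

Lemma uea_act_stable (S : M -> Prop) :
    S 0 -> (forall a x y, S x -> S y -> S (a *: x + y)) ->
    (forall y x, S x -> S (rho y x)) ->
  forall q x, S x -> S (uea_act q x).
Proof.
move=> S0 SP Srho q x Sx; rewrite /uea_act.
elim/malg_ind: (uea_repr q) => [|a w f IH]; first by rewrite free_act0.
rewrite free_actP; apply: SP => //; rewrite free_actU /word_act.
by elim: (w : seq L) => //= y s; exact: Srho.
Qed.

End UeaAction.

(** * Maps out of a Verma module *)

Section VermaMap.
Variables (K : fieldType) (M : lmodType K) (Lop Wop : int -> M -> M).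
Variables (c h hW : K) (x0 : M).

Definition central_term (n m : int) : K :=
  if n + m == 0 then (n ^+ 3 - n)%:~R / 12 * c else 0.

Hypothesis Llin : forall n, linear (Lop n).
Hypothesis Wlin : forall n, linear (Wop n).
Hypothesis LL : forall n m x, Lop n (Lop m x) =
  Lop m (Lop n x) + (n - m)%:~R *: Lop (n + m) x + central_term n m *: x.
Hypothesis LW : forall n m x, Lop n (Wop m x) =
  Wop m (Lop n x) + (n - m)%:~R *: Wop (n + m) x + central_term n m *: x.
Hypothesis WW : forall n m x, Wop n (Wop m x) = Wop m (Wop n x).

Definition gen_act (g : w22_gen) (x : M) : M :=
  match g with GL n => Lop n x | GW n => Wop n x | GC => c *: x end.

Definition w22_act (y : w22 K) (x : M) : M := malg_ext (gen_act^~ x) y.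

Lemma gen_actP g a x x' : gen_act g (a *: x + x') = a *: gen_act g x + gen_act g x'.
Proof.
case: g => [n|n|] /=; [exact: Llin | exact: Wlin |].
by rewrite scalerDr !scalerA mulrC.
Qed.

Lemma gen_actZ g a x : gen_act g (a *: x) = a *: gen_act g x.
Proof.
exact: (scalable_linear (gen_actP g)).
Qed.

Lemma w22_actPl a y z x : w22_act (a *: y + z) x = a *: w22_act y x + w22_act z x.
Proof. exact: malg_ext_is_linear. Qed.

Lemma w22_act0 x : w22_act 0 x = 0.
Proof. exact: (raddf0 (malg_ext _)). Qed.

Lemma w22_actU g x : w22_act << g >> x = gen_act g x.
Proof. exact: malg_extU. Qed.

Lemma w22_actPr y a x x' : w22_act y (a *: x + x') = a *: w22_act y x + w22_act y x'.
Proof.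
elim/w22_ind: y => [|b g y IH]; first by rewrite !w22_act0 scaler0 addr0.
rewrite !w22_actPl IH !w22_actU gen_actP !scalerDr !scalerA mulrC.
by rewrite addrACA.
Qed.

Lemma central_termC n m : central_term m n = - central_term n m.
Proof.
rewrite /central_term addrC; case: eqP => [nm|_]; last by rewrite oppr0.
have -> : m = - n by lia.
by rewrite -!mulNr -rmorphN /=; congr (_%:~R / _ * _); ring.
Qed.

Lemma gen_act_bracket g g' x : w22_act (w22_bracket K g g') x =
  gen_act g (gen_act g' x) - gen_act g' (gen_act g x).
Proof.
have comb a b u : w22_act (a *: << u >> + b *: Cg K) x
    = a *: gen_act u x + b *: (c *: x).
  rewrite w22_actPl w22_actU; congr (_ + _).
  by rewrite -[b *: Cg K]addr0 w22_actPl w22_act0 addr0 w22_actU.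
have coc n m : w22_cocycle K n m * c = central_term n m.
  rewrite /w22_cocycle /central_term -(addr_eq0 n m).
  by case: eqP => _; rewrite ?mul0r.
have Z g1 u : gen_act g1 (c *: u) = c *: gen_act g1 u by exact: gen_actZ.
case: g g' => [n|n|] [m|m|];
  rewrite ?[w22_bracket _ _ _]/= ?comb ?w22_act0 ?Z /= ?subrr //.
- by rewrite scalerA coc LL -[X in _ = X - _]addrA addrAC subrr add0r.
- by rewrite scalerA coc LW -[X in _ = X - _]addrA addrAC subrr add0r.
- rewrite scalerA coc LW (central_termC n m) -(opprB n m) rmorphN !scaleNr (addrC m n).
  by rewrite !opprD !opprK !addrA subrr add0r.
- by rewrite WW subrr.
Qed.

Lemma w22_act_lie y y' x :
  w22_act (lie y y') x = w22_act y (w22_act y' x) - w22_act y' (w22_act y x).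
Proof.
have lie0 z : lie (0 : w22 K) z = 0.
  by have := lieDZl (-1) (0 : w22 K) 0 z; rewrite !scaleN1r !addNr.
have lie0r z : lie z (0 : w22 K) = 0.
  by have := lieDZr (-1) (0 : w22 K) 0 z; rewrite !scaleN1r !addNr.
have act0 z : w22_act z 0 = 0.
  by have := w22_actPr z (-1) 0 0; rewrite !scaleN1r !addNr.
elim/w22_ind: y => [|a g y IH]; first by rewrite lie0 !w22_act0 act0 subrr.
rewrite lieDZl !w22_actPl w22_actPr {}IH opprD addrACA -scalerBr.
congr (_ *: _ + _); elim/w22_ind: y' => [|b g' y' IH].
  by rewrite lie0r !w22_act0 act0 subrr.
rewrite lieDZr !w22_actPl w22_actPr {}IH opprD addrACA -scalerBr.
congr (_ *: _ + _).
by rewrite [lie _ _](w22_lieU K g g') gen_act_bracket !w22_actU.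
Qed.

Hypothesis x0L : forall n, 0 < n -> Lop n x0 = 0.
Hypothesis x0W : forall n, 0 < n -> Wop n x0 = 0.
Hypothesis x0h : Lop 0 x0 = h *: x0.
Hypothesis x0hW : Wop 0 x0 = hW *: x0.

Local Notation V := (verma c h hW).
Local Notation act := (uea_act w22_act).

Lemma act_uL n x : act (uL K n) x = Lop n x.
Proof.
by rewrite (uea_act_in w22_actPl w22_actPr w22_act_lie) w22_actU.
Qed.

Lemma act_uW n x : act (uW K n) x = Wop n x.
Proof.
by rewrite (uea_act_in w22_actPl w22_actPr w22_act_lie) w22_actU.
Qed.

Lemma act_scalar a x : act a%:A x = a *: x.
Proof.
rewrite (uea_actZ w22_actPl w22_actPr w22_act_lie).
by rewrite (uea_act1 w22_actPl w22_actPr w22_act_lie).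
Qed.

Lemma act_verma_rel (q : uea (w22 K)) :
  submod_gen (verma_rel c h hW) q -> act q x0 = 0.
Proof.
have actD := uea_actD w22_actPl w22_actPr w22_act_lie.
have actM := uea_actM w22_actPl w22_actPr w22_act_lie.
have actP := uea_actP w22_actPr.
have act_0 u : act u 0 = 0.
  by have := actP u (-1) 0 0; rewrite !scaleN1r !addNr.
have act0x x : act 0 x = 0.
  have /eqP := actD 0 0 x.
  by rewrite addr0 -subr_eq0 opprD addrA subrr add0r oppr_eq0 => /eqP.
have actB u w x : act (u - w) x = act u x - act w x.
  by apply/eqP; rewrite eq_sym subr_eq -actD subrK.
elim=> {q} [q [[n n0 [->|->]]|[[->|->]|->]]| |q q' _ IH _ IH'|a q _ IH].
- by rewrite act_uL x0L.
- by rewrite act_uW x0W.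
- rewrite actB act_scalar (uea_act_in w22_actPl w22_actPr w22_act_lie) w22_actU.
  by rewrite /= subrr.
- by rewrite actB act_scalar act_uL x0h subrr.
- by rewrite actB act_scalar act_uW x0hW subrr.
- exact: act0x.
- by rewrite actD IH IH' addr0.
- by rewrite (actM a q) IH act_0.
Qed.

(** Universal property: operators satisfying the relations of W(2,2) and a highest
    weight vector [x0] in [M] receive the Verma module. The last clause
    describes how arbitrary elements of the enveloping algebra act: they preserve
    every subspace stable under the generators. *)
Lemma verma_hom : exists Phi : V -> M,
  [/\ Phi (verma_vac c h hW) = x0,
      forall (a : K) (x y : V),
        Phi ((a%:A : uea (w22 K)) *: x + y) = a *: Phi x + Phi y,
      forall n x, Phi (uL K n *: x) = Lop n (Phi x),
      forall n x, Phi (uW K n *: x) = Wop n (Phi x)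
    & forall S : M -> Prop, S 0 ->
        (forall a x y, S x -> S y -> S (a *: x + y)) ->
        (forall n x, S x -> S (Lop n x) /\ S (Wop n x)) ->
      forall (q : uea (w22 K)) x, S (Phi x) -> S (Phi (q *: x))].
Proof.
have actD := uea_actD w22_actPl w22_actPr w22_act_lie.
have actM := uea_actM w22_actPl w22_actPr w22_act_lie.
pose Phi (q : V) := act (lquot_repr q) x0.
have PhiE q : Phi (lquot_pi _ q) = act q x0.
  apply/eqP; rewrite -subr_eq0; apply/eqP.
  rewrite -(@act_verma_rel (lquot_repr (lquot_pi (verma_rel c h hW) q) - q));
    last first.
    by apply/lquot_piP; rewrite lquot_reprK.
  by apply/eqP; rewrite subr_eq -actD subrK.
have PhiZ q x : Phi (q *: x) = act q (Phi x).
  by rewrite -(lquot_reprK x) -linearZ /= !PhiE actM.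
have PhiD x y : Phi (x + y) = Phi x + Phi y.
  by rewrite -(lquot_reprK x) -(lquot_reprK y) -lquot_piD !PhiE actD.
exists Phi; split.
- by rewrite /verma_vac PhiE (uea_act1 w22_actPl w22_actPr w22_act_lie).
- by move=> a x y; rewrite PhiD PhiZ act_scalar.
- by move=> n x; rewrite PhiZ act_uL.
- by move=> n x; rewrite PhiZ act_uW.
- move=> S S0 SP SLW q x Sx; rewrite PhiZ; apply: uea_act_stable => // y {}x {}Sx.
  elim/w22_ind: y => [|a g y IH]; first by rewrite w22_act0.
  rewrite w22_actPl w22_actU. apply: (SP) => //.
  case: g => [n|n|] /=; [exact: (SLW n x Sx).1|exact: (SLW n x Sx).2|].
  by rewrite -[_ *: _]addr0; apply: (SP).
Qed.

End VermaMap.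

(** * Coefficients of Fock vectors *)

Section FockVacuum.
Variables (K : numFieldType) (F : fock_space K) (z al : bool -> K).
Implicit Types (f g : F) (s t : bool).
Local Notation osc := (@osc K F z).
Local Notation nord := (@nord K F z).
Local Notation vir := (@vir K F z al).
Local Notation quad := (@quad K F z al).

Lemma osc_vac s (n : int) : 0 < n -> osc s n (vac F) = 0.
Proof. by case: n => [[|n]|n] // _; rewrite oscS dervar_vac scaler0. Qed.

Lemma osc_zero s n : osc s n 0 = 0.
Proof. exact: raddf0. Qed.

Lemma nord_vac k l : (0 < k) || (0 < l) -> nord k l (vac F) = 0.
Proof.
rewrite /nord; case: (ltrP 0 k) => [k0 _|_ /= l0].
  by rewrite osc_vac // osc_zero.
by rewrite osc_vac // osc_zero.
Qed.

Lemma vir_vac n : 0 < n -> vir n (vac F) = 0.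
Proof.
move=> n0; rewrite virE !osc_vac // !scaler0 addr0 scaler0 subr0.
by apply: zsum0 => k; apply: nord_vac; lia.
Qed.

Definition vacuum_weight : K :=
  z true * z false - al true * z false - al false * z true.

Lemma vir0_vac : vir 0 (vac F) = vacuum_weight *: vac F.
Proof.
rewrite virE (@zsum1 _ _ 0) => [|k k0]; last by apply: nord_vac; lia.
rewrite /nord ltxx subrr !osc0 /vacuum_weight.
by to_coefs; rewrite add0r; ring.
Qed.

Lemma quad_vac s n : 0 < n -> quad s n (vac F) = 0.
Proof.
move=> n0; rewrite quadE osc_vac // scaler0 subr0 zsum0 ?scaler0 // => k.
have [k0|k0] := ltrP 0 k; last by rewrite osc_vac ?osc_zero //; lia.
by rewrite oscCs osc_vac ?osc_zero.
Qed.

Lemma quad0_vac s : quad s 0 (vac F) = (z s ^+ 2 / 2 - al s * z s) *: vac F.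
Proof.
rewrite quadE (@zsum1 _ _ 0) => [|k k0]; last first.
  have [k1|k1] := ltrP 0 k; last by rewrite osc_vac ?osc_zero //; lia.
  by rewrite oscCs osc_vac ?osc_zero.
by rewrite subrr !osc0; to_coefs; rewrite add0r; field.
Qed.

(** In degree one the sum for [W_{-1}] has only the two terms with a zero mode,
    and the background charge has the factor [n + 1 = 0]. *)
Lemma quadN1_vac s : quad s (-1) (vac F) = z s *: mulvar (s, 0%N) (vac F).
Proof.
rewrite quadE addNr mulr0 scale0r subr0.
pose G k := osc s k (osc s (-1 - k) (vac F)).
have G0 k : k \notin [:: 0; -1] -> G k = 0.
  rewrite !inE negb_or /G => kk; have [k1|k1] := ltrP 0 k.
    by rewrite oscCs osc_vac ?osc_zero.
  by rewrite osc_vac ?osc_zero //; lia.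
rewrite (zsumE (r := [:: 0; -1]) _ G0) // !big_cons big_nil addr0 /G subr0 subrr.
rewrite !osc0 (_ : -1 = Negz 0) // oscZ oscN.
by to_coefs; field.
Qed.

End FockVacuum.

Section Coefficients.
Variables (K : numFieldType) (F : fock_space K) (z al : bool -> K).
Local Notation mon := {cmonom (bool * nat)%type}.
Implicit Types (f g : F) (e : mon) (s t : bool).
Local Notation osc := (@osc K F z).
Local Notation nord := (@nord K F z).
Local Notation vir := (@vir K F z al).
Local Notation quad := (@quad K F z al).

Definition afree e := forall k, e (true, k) = 0%N.

Lemma afreeM e k : afree (e ** U_((false, k))) <-> afree e.
Proof.
split=> ea i; first by have := ea i; rewrite cmM; lia.
by rewrite cmM cmU ea.
Qed.

Lemma fcoef_oscN e k f : afree e -> fcoef e (osc true (Negz k) f) = 0.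
Proof. by move=> ea; rewrite oscN fcoef_mulvar0. Qed.

Lemma fcoef_nord_lt0 e k l f : afree e -> k < 0 -> fcoef e (nord k l f) = 0.
Proof.
case: k => // k ea _; rewrite /nord ltNge /=; exact: fcoef_oscN.
Qed.

(** On monomials free of [a] the summands of [L_n] that multiply by an [a] have no
    coefficient. The bound [N] on the number of remaining terms depends on [f],
    and any larger one can be used. *)
Lemma fcoef_vir e n f : afree e -> exists N, forall N', (N <= N')%N ->
  fcoef e (vir n f) =
    (z true - al true * (n + 1)%:~R) * fcoef e (osc false n f)
    - al false * (n + 1)%:~R * fcoef e (osc true n f)
    + \sum_(j < N') j.+1%:R
        * fcoef e (osc false (n - j.+1%:Z) (dervar (false, nat_of_ord j) f)).
Proof.
move=> ea; have [N fN] := dervar_fin f; exists N => N' NN'.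
rewrite virE fcoefD fcoefN fcoefZ fcoefD !fcoefZ.
rewrite (linear_zsum (fcoef e : {linear F -> K^o})) /=; last exact: nord_zfin.
rewrite (@zsumE _ _ [seq i%:Z | i <- iota 0 N'.+1]); first last.
- case=> [[|k]|k] kN; last by rewrite fcoef_nord_lt0.
    by case/mapP: kN; exists 0%N.
  rewrite /nord /= oscS /= fN ?scaler0 ?osc_zero ?fcoef0 //.
  have : (k.+1 \notin iota 0 N'.+1) by apply: contra kN => kN; apply/mapP; exists k.+1.
  by rewrite mem_iota; lia.
- by rewrite map_inj_uniq ?iota_uniq // => i j [].
rewrite big_map -/(index_iota 0 N'.+1) big_mkord big_ord_recl /=.
rewrite {1}/nord ltxx subr0 osc0 fcoefZ.
under eq_bigr => j _ do rewrite /nord /= oscS oscZ fcoefZ /=.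
ring.
Qed.

(** Every summand of [L_0] without a zero mode multiplies by a variable. *)
Lemma fcoef_vir0 f :
  fcoef (@mone _) (vir 0 f) = vacuum_weight z al * fcoef (@mone _) f.
Proof.
have e1 : afree (@mone _) by move=> k; rewrite cm1.
have [N /(_ N (leqnn N)) ->] := fcoef_vir 0 f e1.
rewrite big1 ?addr0 => [|j _]; last first.
  by rewrite sub0r (_ : - j.+1%:Z = Negz j) // oscN fcoef_mulvar0 ?cm1 // mulr0.
by rewrite !osc0 !fcoefZ /vacuum_weight add0r; ring.
Qed.

Lemma fcoef_virN e q f : afree e -> exists N, forall N', (N <= N')%N ->
  fcoef e (vir (Negz q) f) =
    (z true + al true * q%:R) * fcoef e (mulvar (false, q) f)
    + \sum_(j < N') j.+1%:R
        * fcoef e (mulvar (false, (q + j).+1) (dervar (false, nat_of_ord j) f)).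
Proof.
move=> ea; have [N virE] := fcoef_vir (Negz q) f ea.
exists N => N' /virE ->; rewrite fcoef_oscN // mulr0 subr0 oscN.
congr (_ * _ + _).
  have -> : Negz q + 1 = - q%:Z by lia.
  by rewrite rmorphN mulrN opprK.
apply: eq_bigr => j _; have -> : Negz q - j.+1%:Z = Negz (q + j).+1 by lia.
by rewrite oscN.
Qed.

Lemma fcoef_virS e q f : afree e -> exists N, forall N', (N <= N')%N ->
  fcoef e (vir q.+1%:Z f) =
    (z true - al true * q.+2%:R) * q.+1%:R * fcoef e (dervar (true, q) f)
    + (z false - al false * q.+2%:R) * q.+1%:R * fcoef e (dervar (false, q) f)
    + \sum_(j < q) (q - j)%:R * j.+1%:R
        * fcoef e (dervar (true, (q - j).-1) (dervar (false, nat_of_ord j) f))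
    + \sum_(i < N') (q + i).+2%:R
        * fcoef e (mulvar (false, nat_of_ord i) (dervar (false, (q + i).+1) f)).
Proof.
move=> ea; have [N virE] := fcoef_vir q.+1%:Z f ea.
exists N => N' NN'; rewrite (virE (q.+1 + N')%N); last by lia.
rewrite big_split_ord big_ord_recr /=.
have -> : q.+1%:Z + 1 = q.+2%:Z by lia.
rewrite !oscS subrr osc0 !fcoefZ.
have -> : \sum_(j < q) j.+1%:R
        * fcoef e (osc false (q.+1%:Z - j.+1%:Z) (dervar (false, nat_of_ord j) f))
   = \sum_(j < q) (q - j)%:R * j.+1%:R
        * fcoef e (dervar (true, (q - j).-1) (dervar (false, nat_of_ord j) f)).
  apply: eq_bigr => j _; have jq := ltn_ord j.
  have -> : q.+1%:Z - j.+1%:Z = (q - j).-1.+1%:Z by lia.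
  rewrite oscS fcoefZ prednK ?subn_gt0 //=; ring.
have -> : \sum_(i < N') (q.+1 + i).+1%:R
    * fcoef e (osc false (q.+1%:Z - (q.+1 + i).+1%:Z) (dervar (false, (q.+1 + i)%N) f))
   = \sum_(i < N') (q + i).+2%:R
        * fcoef e (mulvar (false, nat_of_ord i) (dervar (false, (q + i).+1) f)).
  apply: eq_bigr => i _.
  have -> : q.+1%:Z - (q.+1 + i).+1%:Z = Negz i by lia.
  by rewrite oscN addSn.
rewrite -!pmulrn /=; ring.
Qed.

(** Negative modes preserve the ideal generated by the [a_{-k}], so modulo it they
    depend only on the terms free of [a]. *)
Lemma afree_virN e f g q : afree e ->
    (forall e', afree e' -> fcoef e' f = fcoef e' g) ->
  fcoef e (vir (Negz q) f) = fcoef e (vir (Negz q) g).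
Proof.
move=> ea fg; have [N fE] := fcoef_virN q f ea; have [N' gE] := fcoef_virN q g ea.
rewrite (fE (N + N')%N) ?leq_addr // (gE (N + N')%N) ?leq_addl //.
have mE k (u v : F) : (forall e', afree e' -> fcoef e' u = fcoef e' v) ->
    fcoef e (mulvar (false, k) u) = fcoef e (mulvar (false, k) v).
  move=> uv; have [e0|[e' ee']] := cm_case e (false, k).
    by rewrite !fcoef_mulvar0.
  by move: ea; rewrite ee' => /afreeM /uv; rewrite !fcoef_mulvar.
rewrite (mE _ f g fg); congr (_ + _); apply: eq_bigr => j _; congr (_ * _).
apply: mE => e' e'a; rewrite !fcoef_dervar; congr (_ * _).
by apply: fg; apply/afreeM.
Qed.

Lemma afree_quadN e q f : afree e -> fcoef e (quad true (Negz q) f) = 0.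
Proof.
move=> ea; rewrite quadE fcoefD fcoefN !fcoefZ fcoef_oscN // mulr0 subr0.
rewrite (linear_zsum (fcoef e : {linear F -> K^o})) /=; last exact: osc2_zfin.
rewrite zsum0 ?mulr0 // => -[k|k]; last exact: fcoef_oscN.
rewrite oscCs; have -> : Negz q - k%:Z = Negz (q + k) by lia.
exact: fcoef_oscN.
Qed.

(** From here on [p = P.+1], so that [b_{-p}] is the variable [(false, P)] and
    [L_{-p}] is [vir (Negz P)]. *)
Section LowestComponent.
Variables (P : nat).
Local Notation T := (z true + al true * P%:R).

Definition bpow (r : nat) : mon := iter r (fun e => e ** U_((false, P))) (@mone _).

Lemma bpowE r i : bpow r i = ((i == (false, P)) * r)%N.
Proof.
elim: r => [|r IH] /=; first by rewrite cm1 muln0.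
by rewrite cmM IH cmU eq_sym mulnS addnC.
Qed.

Lemma afree_bpow r : afree (bpow r).
Proof. by move=> k; rewrite bpowE. Qed.

Lemma mdeg_bpow r : mdeg (bpow r) = r.
Proof. by elim: r => [|r IH] /=; rewrite ?mdeg1 // mdegM mdegU IH addn1. Qed.

Definition Lpow (r : nat) : F := iter r (vir (Negz P)) (vac F).

(** Modulo [a], each [L_{-p}] is [T b_{-p}] plus terms [b_{-p-k} d/db_{-k}] that
    do not raise the degree in [b]. *)
Lemma fcoef_Lpow_top r e : afree e -> (r <= mdeg e)%N ->
  fcoef e (Lpow r) = if e == bpow r then T ^+ r else 0.
Proof.
elim: r e => [|r IH] e ea er.
  by rewrite fcoef_vac expr0; case: eqP.
have [N /(_ N (leqnn N)) ->] := fcoef_virN P (Lpow r) ea.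
rewrite big1 ?addr0 => [|j _]; last first.
  have [e0|[e' ee']] := cm_case e (false, (P + j).+1).
    by rewrite fcoef_mulvar0 ?mulr0.
  move: ea er; rewrite ee' => /afreeM ea; rewrite mdegM mdegU => er.
  rewrite fcoef_mulvar fcoef_dervar IH; last 2 first.
  - exact/afreeM.
  - by rewrite mdegM mdegU; lia.
  case: eqP => [eb|_]; last by rewrite !mulr0.
  have := congr1 (@mdeg _) eb; rewrite mdeg_bpow mdegM mdegU; lia.
have [e0|[e' ee']] := cm_case e (false, P).
  rewrite fcoef_mulvar0 // mulr0; case: eqP => // eb.
  by move: e0; rewrite eb bpowE eqxx; lia.
move: ea er; rewrite ee' => /afreeM ea; rewrite mdegM mdegU addn1 ltnS => er.
rewrite fcoef_mulvar IH //=.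
have -> : (e' ** U_((false, P)) == bpow r ** U_((false, P))) = (e' == bpow r).
  by apply/eqP/eqP => [/mulcmI|->].
by case: eqP; rewrite ?mulr0 // exprS.
Qed.

(** The monomial [b_{-p}^r b_{-2p}] arises when one of the [r.+2] factors
    differentiates a [b_{-p}] created before it, whence the binomial number. *)
Lemma fcoef_Lpow_next r :
  fcoef (bpow r ** U_((false, (P + P).+1))) (Lpow r.+2)
  = T ^+ r.+1 * P.+1%:R * r.+2%:R * r.+1%:R / 2.
Proof.
elim: r => [|r IH]; set e := _ ** U_(_).
  have ea : afree e by apply/afreeM; exact: (afree_bpow 0).
  have [N /(_ (N + P.+1)%N (leq_addr _ _)) ->] := fcoef_virN P (Lpow 1) ea.
  rewrite fcoef_mulvar0 ?mulr0 ?add0r; last first.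
    by rewrite /e cmM cmU bpowE muln0 xpair_eqE /=; lia.
  have PN : (P < N + P.+1)%N by lia.
  rewrite (bigD1 (Ordinal PN)) //= big1 ?addr0 => [|j jP]; last first.
    rewrite fcoef_mulvar0 ?mulr0 // /e cmM cmU bpowE muln0 xpair_eqE /=.
    by move: jP; rewrite -val_eqE /=; lia.
  rewrite fcoef_mulvar fcoef_dervar (@fcoef_Lpow_top 1) /=; last 2 first.
  - exact: (afree_bpow 1).
  - by rewrite mdegM mdegU; lia.
  by rewrite eqxx cm1 !expr1; field.
have ea : afree e by apply/afreeM; exact: (afree_bpow r.+1).
have [N /(_ (N + P.+1)%N (leq_addr _ _)) ->] := fcoef_virN P (Lpow r.+2) ea.
rewrite {1}/e [bpow r.+1]/= mulcmAC fcoef_mulvar IH.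
have PN : (P < N + P.+1)%N by lia.
rewrite (bigD1 (Ordinal PN)) //= big1 ?addr0 => [|j jP]; last first.
  rewrite fcoef_mulvar0 ?mulr0 // /e cmM cmU bpowE !xpair_eqE /=.
  by move: jP; rewrite -val_eqE /=; lia.
rewrite fcoef_mulvar fcoef_dervar (@fcoef_Lpow_top r.+2); last 2 first.
- exact: (afree_bpow r.+2).
- by rewrite mdegM mdegU mdeg_bpow addn1.
rewrite eqxx bpowE eqxx mul1n [in RHS]exprS.
by rewrite -!natr1 !exprS; field.
Qed.

(** Here [f] is the image of [u], and [L_{-p}] occurs to the power [r.+1]. *)
Section Obstruction.
Variables (r : nat) (f : F).
Hypothesis al_neq0 : al true != 0.
Hypothesis zE : z true = al true * P.+2%:R.
Hypothesis fE : forall e, afree e -> fcoef e f = fcoef e (Lpow r.+1).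
Hypothesis sing : forall q e, (q <= P)%N -> afree e ->
  fcoef e (vir q.+1%:Z f) = 0.

Lemma fcoef_top e : afree e -> (r < mdeg e)%N ->
  fcoef e f = if e == bpow r.+1 then T ^+ r.+1 else 0.
Proof. by move=> ea er; rewrite fE // fcoef_Lpow_top. Qed.

Lemma fcoef_above e : afree e -> (r.+1 < mdeg e)%N -> fcoef e f = 0.
Proof.
move=> ea er; rewrite fcoef_top //; last by lia.
by case: eqP er => // ->; rewrite mdeg_bpow ltnn.
Qed.

Lemma fcoef_mulvar_above e k j : afree e -> (r.+1 < mdeg e)%N ->
  fcoef e (mulvar (false, k) (dervar (false, j) f)) = 0.
Proof.
move=> ea er; have [e0|[e' ee']] := cm_case e (false, k).
  by rewrite fcoef_mulvar0.
move: ea er; rewrite ee' => /afreeM ea; rewrite mdegM mdegU => er.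
rewrite fcoef_mulvar fcoef_dervar fcoef_above ?mulr0 ?mdegM ?mdegU //.
exact/afreeM.
Qed.

(** Since [L_n] with [n < p] acts on the part of degree one in [a] through a
    nonzero multiple of the derivative in [a_{-n}], the vanishing of [L_n f]
    determines that part; in particular it has degree at most [r.+1] in [b]. *)
Lemma fcoef_a_above q e : (q < P)%N -> afree e -> (r.+1 < mdeg e)%N ->
  fcoef (e ** U_((true, q))) f = 0.
Proof.
elim/ltn_ind: q e => q IH e qP ea er.
have [N /(_ N (leqnn N))] := fcoef_virS q f ea.
rewrite sing //; last exact: ltnW.
rewrite (fcoef_dervar (true, q)) ea mul1r fcoef_dervar.
rewrite (@fcoef_above (e ** U_((false, q)))) ?mdegM ?mdegU; [|exact/afreeM|lia].
rewrite big1 => [|j _]; last first.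
  have jq := ltn_ord j.
  by rewrite !fcoef_dervar mulcmAC IH ?mulr0 ?mdegM ?mdegU //;
    [lia|lia|exact/afreeM|lia].
rewrite big1 => [|j _]; last by rewrite fcoef_mulvar_above ?mulr0.
rewrite !mulr0 !addr0 zE => /esym/eqP; rewrite !mulf_eq0 pnatr_eq0 /= orbF.
case/orP => [/eqP|/eqP //].
have -> : al true * P.+2%:R - al true * q.+2%:R = al true * (P - q)%:R.
  by rewrite -mulrBr natrB ?(ltnW qP) // -!natr1; congr (_ * _); ring.
move/eqP; rewrite mulf_eq0 (negPf al_neq0) /= pnatr_eq0; lia.
Qed.

(** In [L_n f] with [n = q.+1 < p], at the monomial [b_{-(p-n)} b_{-p}^r], the
    only contributions are the unknown coefficient of its product by [a_{-n}] and
    the term of [L_n] that turns a factor [b_{-p}] into [b_{-(p-n)}]. *)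
Lemma fcoef_a_next q : (q < P)%N ->
  al true * (P - q)%:R * q.+1%:R
    * fcoef (bpow r ** U_((false, (P - q).-1)) ** U_((true, q))) f
  = - (P.+1%:R * r.+1%:R * T ^+ r.+1).
Proof.
move=> qP; set e := bpow r ** _.
have ea : afree e by apply/afreeM; exact: afree_bpow.
have degE : mdeg e = r.+1 by rewrite mdegM mdegU mdeg_bpow addn1.
have eE : e = bpow r ** U_((false, (P - q).-1)) by [].
clearbody e.
have [N /(_ (N + P)%N (leq_addr _ _))] := fcoef_virS q f ea.
rewrite sing //; last exact: ltnW.
rewrite (fcoef_dervar (true, q)) ea mul1r fcoef_dervar.
rewrite (@fcoef_above (e ** U_((false, q)))) ?mdegM ?mdegU; [|exact/afreeM|lia].
rewrite big1 => [|j _]; last first.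
  rewrite !fcoef_dervar mulcmAC fcoef_a_above ?mulr0 ?mdegM ?mdegU //.
  - have := ltn_ord j; lia.
  - exact/afreeM.
  - lia.
have PN : ((P - q).-1 < N + P)%N by lia.
rewrite (bigD1 (Ordinal PN)) //= big1 ?addr0 => [|j jP]; last first.
  have [e0|[e' ee']] := cm_case e (false, nat_of_ord j).
    by rewrite fcoef_mulvar0 ?mulr0.
  move: (ea) degE; rewrite ee' => /afreeM e'a; rewrite mdegM mdegU => degE.
  rewrite fcoef_mulvar fcoef_dervar fcoef_top ?mdegM ?mdegU; [|exact/afreeM|lia].
  case: eqP => [eb|_]; last by rewrite !mulr0.
  have := congr1 (fun m : mon => m (false, (q + j).+1)) eb.
  rewrite cmM cmUU bpowE xpair_eqE /=.
  by move: jP; rewrite -val_eqE /=; lia.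
have -> : (q + (P - q).-1).+1 = P by lia.
have -> : fcoef e (mulvar (false, (P - q).-1) (dervar (false, P) f))
    = r.+1%:R * T ^+ r.+1.
  rewrite eE fcoef_mulvar fcoef_dervar -/(bpow r.+1) fcoef_top.
  - by rewrite eqxx bpowE eqxx mul1n.
  - exact: (afree_bpow r.+1).
  - by rewrite (mdeg_bpow r.+1).
rewrite !mulr0 !addr0 zE => /esym/eqP.
rewrite addr_eq0 => /eqP.
have -> : al true * P.+2%:R - al true * q.+2%:R = al true * (P - q)%:R.
  by rewrite -mulrBr natrB ?(ltnW qP) // -!natr1; congr (_ * _); ring.
by move=> ->; rewrite mulrA.
Qed.

(** In [L_p f], at the monomial [b_{-p}^r], the coefficient of the product by
    [a_{-p}] is multiplied by [z true - al true * P.+2 = 0]; what remains is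
    known. *)
Lemma obstruction :
  T * (z false - al false * P.+2%:R) - P%:R * T / al true + P.+1%:R * r%:R = 0.
Proof.
have T_neq0 : T != 0.
  have -> : T = al true * (P.+1%:R * 2) by rewrite zE -!natr1; ring.
  by rewrite !mulf_neq0 ?pnatr_eq0.
have ea := afree_bpow r.
have [N /(_ (N + P.+1)%N (leq_addr _ _))] := fcoef_virS P f ea.
rewrite sing // zE subrr !mul0r add0r fcoef_dervar -/(bpow r.+1) fcoef_top;
  last 2 first.
- exact: (afree_bpow r.+1).
- by rewrite (mdeg_bpow r.+1).
rewrite eqxx bpowE eqxx mul1n.
have -> : \sum_(j < P) (P - j)%:R * j.+1%:R * fcoef (bpow r)
      (dervar (true, (P - j).-1) (dervar (false, nat_of_ord j) f))
    = - (P%:R * (P.+1%:R * r.+1%:R * T ^+ r.+1) / al true).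
  under eq_bigr => j _.
    have jP := ltn_ord j.
    have -> : (P - j)%:R * j.+1%:R * fcoef (bpow r)
        (dervar (true, (P - j).-1) (dervar (false, nat_of_ord j) f))
      = - (P.+1%:R * r.+1%:R * T ^+ r.+1) / al true.
      have qP : ((P - j).-1 < P)%N by lia.
      rewrite -(fcoef_a_next qP) !fcoef_dervar afree_bpow mul1r.
      rewrite cmM cmU bpowE !xpair_eqE /=.
      have -> : (nat_of_ord j == P) = false by lia.
      have -> : (P - (P - j).-1).-1 = j by lia.
      have -> : (P - (P - j).-1)%N = j.+1 by lia.
      have -> : (P - j).-1.+1 = (P - j)%N by lia.
      by rewrite mul0n mulcmAC; field.
    over.
  by rewrite sumr_const card_ord -mulr_natl; field.
have -> : \sum_(i < N + P.+1) (P + i).+2%:R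
    * fcoef (bpow r) (mulvar (false, nat_of_ord i) (dervar (false, (P + i).+1) f))
  = P.+1%:R ^+ 2 * r.+1%:R * r%:R * T ^+ r.
  have PN : (P < N + P.+1)%N by lia.
  rewrite (bigD1 (Ordinal PN)) //= big1 ?addr0 => [|j jP]; last first.
    rewrite fcoef_mulvar0 ?mulr0 // bpowE xpair_eqE /=.
    by move: jP; rewrite -val_eqE /=; lia.
  case: (r) fE => [|r'] fE'.
    by rewrite fcoef_mulvar0 ?cm1 // !mulr0 mul0r.
  rewrite [bpow r'.+1]/= fcoef_mulvar fcoef_dervar fE'; last first.
    by apply/afreeM; exact: afree_bpow.
  rewrite fcoef_Lpow_next bpowE xpair_eqE /=.
  have -> : ((P + P).+1 == P) = false by lia.
  have -> : (P + P).+2%:R = 2 * P.+1%:R :> K by rewrite -!natr1 natrD; ring.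
  by rewrite mul0n; field.
move=> E; have nz : P.+1%:R * r.+1%:R * T ^+ r != 0.
  by rewrite !mulf_neq0 ?expf_neq0 ?pnatr_eq0.
by apply: (mulfI nz); rewrite mulr0 [RHS]E exprS zE; field.
Qed.

End Obstruction.

End LowestComponent.

End Coefficients.

(** * Transporting submodules and lowest components *)

Section NegativeSpan.
Variables (K : fieldType) (M : lmodType K) (Lop Wop : int -> M -> M) (c : K).
Hypothesis Llin : forall n, linear (Lop n).
Hypothesis Wlin : forall n, linear (Wop n).
Hypothesis LL : forall n m x, Lop n (Lop m x) =
  Lop m (Lop n x) + (n - m)%:~R *: Lop (n + m) x + central_term c n m *: x.
Hypothesis LW : forall n m x, Lop n (Wop m x) =
  Wop m (Lop n x) + (n - m)%:~R *: Wop (n + m) x + central_term c n m *: x.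
Hypothesis WW : forall n m x, Wop n (Wop m x) = Wop m (Wop n x).

Inductive neg_span (x : M) : M -> Prop :=
| neg_span_in : neg_span x x
| neg_span0 : neg_span x 0
| neg_spanP a y y' : neg_span x y -> neg_span x y' -> neg_span x (a *: y + y')
| neg_spanL n y : n < 0 -> neg_span x y -> neg_span x (Lop n y)
| neg_spanW n y : n < 0 -> neg_span x y -> neg_span x (Wop n y).

Lemma neg_spanZ x a y : neg_span x y -> neg_span x (a *: y).
Proof.
by move=> y_in; rewrite -[_ *: _]addr0; apply: neg_spanP => //; exact: neg_span0.
Qed.

Lemma neg_spanD x y y' : neg_span x y -> neg_span x y' -> neg_span x (y + y').
Proof. by move=> y_in y'_in; rewrite -[y]scale1r; exact: neg_spanP. Qed.

(** This plays the part of the triangular decomposition: moving a nonnegative mode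
    to the right through negative modes either kills the singular vector or
    leaves a combination of shorter products of negative modes. *)
Lemma neg_span_stable x (a b : K) :
    (forall n, 0 < n -> Lop n x = 0) -> (forall n, 0 < n -> Wop n x = 0) ->
    Lop 0 x = a *: x -> Wop 0 x = b *: x ->
  forall n y, neg_span x y -> neg_span x (Lop n y) /\ neg_span x (Wop n y).
Proof.
move=> Lx Wx L0x W0x n y y_in; elim: y_in n => {y}
  [||e y y' _ IH _ IH'|m y m0 y_in IH|m y m0 y_in IH] n.
- have [n0|n0|->] := ltrgtP n 0.
  + by split; [apply: neg_spanL|apply: neg_spanW] => //; exact: neg_span_in.
  + by rewrite Lx // Wx //; split; exact: neg_span0.
  + by rewrite L0x W0x; split; apply: neg_spanZ; exact: neg_span_in.
- have L0 : Lop n 0 = 0 by have := Llin n (-1) 0 0; rewrite !scaleN1r !addNr.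
  have W0 : Wop n 0 = 0 by have := Wlin n (-1) 0 0; rewrite !scaleN1r !addNr.
  by rewrite L0 W0; split; exact: neg_span0.
- have [[Ly Wy] [Ly' Wy']] := (IH n, IH' n).
  by rewrite Llin Wlin; split; exact: neg_spanP.
- have [Ly Wy] := IH n; split.
  + rewrite LL; do ![apply: neg_spanD | apply: neg_spanZ] => //.
      exact: neg_spanL.
    exact: (IH _).1.
  + have -> : Wop n (Lop m y) = Lop m (Wop n y)
        + (- ((m - n)%:~R *: Wop (m + n) y + central_term c m n *: y)).
      by rewrite LW -[X in _ = X + _]addrA addrK.
    rewrite -scaleN1r; do ![apply: neg_spanD | apply: neg_spanZ] => //.
      exact: neg_spanL.
    exact: (IH _).2.
- have [Ly Wy] := IH n; split.
  + rewrite LW; do ![apply: neg_spanD | apply: neg_spanZ] => //.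
      exact: neg_spanW.
    exact: (IH _).2.
  + by rewrite WW; exact: neg_spanW.
Qed.

End NegativeSpan.

Section Transport.
Variables (K : fieldType) (c h hW : K).
Local Notation V := (verma c h hW).
Local Notation v := (verma_vac c h hW).
Local Notation U := (uea (w22 K)).
Variables (M : lmodType K) (Lop Wop : int -> M -> M) (x0 : M) (Phi : V -> M).
Hypothesis Phi_vac : Phi v = x0.
Hypothesis PhiP : forall (a : K) (x y : V),
  Phi ((a%:A : U) *: x + y) = a *: Phi x + Phi y.
Hypothesis PhiL : forall n x, Phi (uL K n *: x) = Lop n (Phi x).
Hypothesis PhiW : forall n x, Phi (uW K n *: x) = Wop n (Phi x).
Hypothesis Phi_stable : forall S : M -> Prop, S 0 ->
    (forall a x y, S x -> S y -> S (a *: x + y)) ->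
    (forall n x, S x -> S (Lop n x) /\ S (Wop n x)) ->
  forall (q : U) x, S (Phi x) -> S (Phi (q *: x)).

Lemma Phi0 : Phi 0 = 0.
Proof.
have := PhiP (-1) 0 0; rewrite scaler0 addr0 scaleN1r => ->.
by rewrite addNr.
Qed.

Lemma PhiD x y : Phi (x + y) = Phi x + Phi y.
Proof. by have := PhiP 1 x y; rewrite !scale1r. Qed.

Lemma PhiZ (a : K) x : Phi ((a%:A : U) *: x) = a *: Phi x.
Proof. by have := PhiP a x 0; rewrite Phi0 !addr0. Qed.

Lemma Phi_sum (I : Type) (s : seq I) (P : pred I) (E : I -> V) :
  Phi (\sum_(i <- s | P i) E i) = \sum_(i <- s | P i) Phi (E i).
Proof. exact: (big_morph Phi PhiD Phi0). Qed.

Lemma Phi_lincomb (I : choiceType) (b : I -> V) (f : {malg K[I]}) :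
  Phi (lincomb b f) = \sum_(i <- msupp f) f@_i *: Phi (b i).
Proof. by rewrite /lincomb Phi_sum; apply: eq_bigr => i _; rewrite PhiZ. Qed.

Lemma Phi_prodW (s : seq nat) x :
  Phi ((\prod_(m <- s) uW K (- m%:Z)) *: x)
  = foldr (fun m : nat => Wop (- m%:Z)) (Phi x) s.
Proof.
by elim: s => [|m s IH]; rewrite ?big_nil ?scale1r // big_cons -scalerA PhiW IH.
Qed.

Lemma Phi_prodL (s : seq nat) x :
  Phi ((\prod_(m <- s) uL K (- m%:Z)) *: x)
  = foldr (fun m : nat => Lop (- m%:Z)) (Phi x) s.
Proof.
by elim: s => [|m s IH]; rewrite ?big_nil ?scale1r // big_cons -scalerA PhiL IH.
Qed.

Lemma Phi_pbw i : Phi (pbw c h hW i) =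
  foldr (fun m : nat => Wop (- m%:Z))
    (foldr (fun m : nat => Lop (- m%:Z)) x0 (val i.2)) (val i.1).
Proof. by rewrite /pbw -scalerA Phi_prodW Phi_prodL Phi_vac. Qed.

Lemma Phi_Lpow n r : Phi (uL K n ^+ r *: v) = iter r (Lop n) x0.
Proof.
elim: r => [|r IH]; first by rewrite expr0 scale1r.
by rewrite exprS -scalerA PhiL IH.
Qed.

Lemma Wspan_ind (P : M -> Prop) : P 0 ->
    (forall a x y, P x -> P y -> P (a *: x + y)) ->
    (forall s : seq nat, 0%N \notin s ->
       P (foldr (fun m : nat => Wop (- m%:Z)) x0 s)) ->
  forall x, Wspan x -> P (Phi x).
Proof.
move=> P0 PP Ps _ [f _ <-]; rewrite Phi_lincomb.
elim/big_rec: _ => // s x _ Px; apply: PP => //.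
rewrite Phi_prodW Phi_vac; apply: Ps.
by case/andP: (valP s).
Qed.

Lemma submod_gen_stable (S : M -> Prop) (u' : V) : S 0 ->
    (forall a x y, S x -> S y -> S (a *: x + y)) ->
    (forall n x, S x -> S (Lop n x) /\ S (Wop n x)) -> S (Phi u') ->
  forall x, submod_gen [set u'] x -> S (Phi x).
Proof.
move=> S0 SP Sst Su' x gx; elim: gx => {x} [x -> //||x y _ IH _ IH'|q x _ IH].
- by rewrite Phi0.
- by rewrite PhiD -[Phi x]scale1r; exact: SP.
- exact: Phi_stable.
Qed.

(** If the subspace [S] contains the images of all basis vectors of positive
    degree in [W] but not that of [y], then the lowest degree must be 0 and [x]
    agrees with [y] modulo [S]. *)
Lemma lowest_component_mod (S : M -> Prop) x y : S 0 ->
    (forall a x y, S x -> S y -> S (a *: x + y)) ->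
    (forall i, (0 < Wdeg i)%N -> S (Phi (pbw c h hW i))) ->
    lowest_component x y -> ~ S (Phi y) -> S (Phi x - Phi y).
Proof.
move=> S0 SP Spbw [f [d [-> low <- _]]] nS.
have Ssum (Q : pred (ptn * ptn)%type) :
    (forall i, Q i -> S (Phi (pbw c h hW i))) ->
    S (\sum_(i <- msupp f | Q i) f@_i *: Phi (pbw c h hW i)).
  by move=> QS; elim/big_rec: _ => // i z /QS Si Sz; exact: SP.
have PhiWcomp d' : Phi (Wcomp c h hW d' f)
    = \sum_(i <- msupp f | Wdeg i == d') f@_i *: Phi (pbw c h hW i).
  by apply: etrans (Phi_sum _ _ _) _; apply: eq_bigr => i _; exact: PhiZ.
case: d low nS => [|d] _ nS; last first.
  case: nS; rewrite PhiWcomp; apply: Ssum => i /eqP di; apply: Spbw.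
  by rewrite di.
rewrite Phi_lincomb (bigID (fun i => Wdeg i == 0%N)) /= PhiWcomp addrAC subrr add0r.
by apply: Ssum => i i0; apply: Spbw; rewrite lt0n.
Qed.

Lemma singular_annihilated (x : V) n : singular x -> 0 < n ->
  Lop n (Phi x) = 0 /\ Wop n (Phi x) = 0.
Proof.
move=> [_ sx] n0; have [Lx Wx] : uL K n *: x = 0 /\ uW K n *: x = 0.
  by split; apply: sx => g; rewrite msuppU oner_eq0 inE => /eqP ->.
by split; [rewrite -(PhiL n x) Lx Phi0 | rewrite -(PhiW n x) Wx Phi0].
Qed.

Lemma subsingular_annihilated (u' u : V) n : subsingular u' u -> 0 < n ->
  submod_gen [set u'] (uL K n *: u).
Proof.
move=> [_ [_ su]] n0; have := su (Lg K n).
rewrite -linearZ /=; have <- : lquot_pi [set u'] 0 = 0 by exact: raddf0.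
move=> E; have /lquot_piP : lquot_pi [set u'] (uL K n *: u) = lquot_pi [set u'] 0.
  by apply: E => g; rewrite msuppU oner_eq0 inE => /eqP ->.
by rewrite subr0.
Qed.

End Transport.

(** * Nonzero central charge *)

Lemma central_term_quad (K : numFieldType) (c a : K) (n m : int) :
    a ^+ 2 = - c / 12 ->
  central_term c n m
  = - (if n + m == 0 then a ^+ 2 * (n ^+ 3 - n)%:~R else 0).
Proof.
move=> ->; rewrite /central_term; case: eqP => _; last by rewrite oppr0.
by move: (_ %:~R : K) => x; field.
Qed.

Section CentralChargeNonzero.
Variables (K : numFieldType) (F : fock_space K) (z al : bool -> K).
Variables (c h hW : K) (P r : nat).
Local Notation V := (verma c h hW).
Local Notation v := (verma_vac c h hW).
Local Notation vir := (@vir K F z al).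
Local Notation quad := (@quad K F z al true).

Definition a_ideal (f : F) := forall e, afree e -> fcoef e f = 0.

Lemma a_ideal0 : a_ideal 0.
Proof. by move=> e _; exact: fcoef0. Qed.

Lemma a_idealP d f g : a_ideal f -> a_ideal g -> a_ideal (d *: f + g).
Proof.
by move=> If Ig e ea; rewrite fcoefP (If e ea) (Ig e ea) mulr0 addr0.
Qed.

Lemma a_ideal_quadN n f : n < 0 -> a_ideal (quad n f).
Proof. by case: n => [//|n _ e ea]; exact: afree_quadN. Qed.

Lemma a_ideal_virN n f : n < 0 -> a_ideal f -> a_ideal (vir n f).
Proof.
case: n => [//|n _ If e ea].
rewrite (@afree_virN _ _ z al e f 0 n ea) ?raddf0 ?fcoef0 // => e' e'a.
by rewrite (If e' e'a) fcoef0.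
Qed.

Hypothesis al_neq0 : al true != 0.
Hypothesis zE : z true = al true * P.+2%:R.
Hypothesis alE : al true ^+ 2 = - c / 12.
Hypothesis cE : 2 - 24 * al true * al false = c.
Hypothesis hE : vacuum_weight z al = h.
Hypothesis hWE : z true ^+ 2 / 2 - al true * z true = hW.

Lemma vir_vir_c n m f : vir n (vir m f) =
  vir m (vir n f) + (n - m)%:~R *: vir (n + m) f + central_term c n m *: f.
Proof. by rewrite vir_vir cE. Qed.

Lemma vir_quad_c n m f : vir n (quad m f) =
  quad m (vir n f) + (n - m)%:~R *: quad (n + m) f + central_term c n m *: f.
Proof. by rewrite (central_term_quad n m alE) scaleNr; exact: vir_quad. Qed.

Lemma vir0_vac_c : vir 0 (vac F) = h *: vac F.
Proof. by rewrite vir0_vac hE. Qed.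

Lemma quad0_vac_c : quad 0 (vac F) = hW *: vac F.
Proof. by rewrite quad0_vac hWE. Qed.

(** Both [u'] and [u - L_{-p}^{r+1} v] are mapped into the ideal of the [a_{-k}]: [u']
    because its constant term has the wrong weight, the difference because it
    involves only basis vectors with some [W_{-m}]. *)
Lemma subsingular_obstruction (u' u : V) :
    singular u' -> L0_eigenvector (h + P.+1%:R) u' -> Wspan u' ->
    subsingular u' u -> lowest_component u (uL K (- P.+1%:Z) ^+ r.+1 *: v) ->
  (z true + al true * P%:R) * (z false - al false * P.+2%:R)
    - P%:R * (z true + al true * P%:R) / al true + P.+1%:R * r%:R = 0.
Proof.
move=> sing_u' [_ wt_u'] W_u' sub_u low_u.
have P0 : P.+1%:R != 0 :> K by rewrite pnatr_eq0.
have [Phi [Phiv PhiP PhiL PhiW Phi_stable]] :=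
  verma_hom (vir_is_linear z al) (quad_is_linear z al true)
    vir_vir_c vir_quad_c (quadC z al true)
    (@vir_vac K F z al) (@quad_vac K F z al true) vir0_vac_c quad0_vac_c.
have Phi_annih n := singular_annihilated PhiP PhiL PhiW (n := n) sing_u'.
have L0u' : vir 0 (Phi u') = (h + P.+1%:R) *: Phi u'.
  by rewrite -PhiL wt_u' (PhiZ PhiP).
have W0u' : quad 0 (Phi u') = hW *: Phi u'.
  apply: (Wspan_ind Phiv PhiP PhiW (P := fun f => quad 0 f = hW *: f)) W_u'.
  - by rewrite raddf0 scaler0.
  - by move=> d x y xE yE; rewrite linearP /= xE yE scalerDr !scalerA mulrC.
  - move=> s _; elim: s => [|m s IH] /=; first exact: quad0_vac_c.
    by rewrite quadC IH quadZ.
have Iu' : a_ideal (Phi u').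
  have [k kE] : exists k, forall e, afree e ->
      fcoef e (Phi u') = k * (e == @mone _)%:R.
    apply: (Wspan_ind Phiv PhiP PhiW (P := fun f => exists k, forall e,
      afree e -> fcoef e f = k * (e == @mone _)%:R)) W_u'.
    - by exists 0 => e _; rewrite mul0r fcoef0.
    - move=> d x y [k kE] [k' k'E]; exists (d * k + k') => e ea.
      by rewrite fcoefP (kE e ea) (k'E e ea) mulrDl mulrA.
    - case=> [|m s] s0; first by exists 1 => e _; rewrite fcoef_vac mul1r.
      exists 0 => e ea; rewrite mul0r; apply: a_ideal_quadN ea.
      by case: m s0 => // m; rewrite inE.
  have e1 : afree (@mone _) by move=> i; rewrite cm1.
  have := fcoef_vir0 z al (Phi u'); rewrite L0u' fcoefZ hE (kE _ e1) eqxx mulr1.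
  move=> /eqP; rewrite mulrDl -subr_eq0 addrAC subrr add0r mulf_eq0 (negPf P0) /=.
  by move=> /eqP k0 e ea; rewrite (kE e ea) k0 mul0r.
have stable := neg_span_stable (vir_is_linear z al) (quad_is_linear z al true)
  vir_vir_c vir_quad_c (quadC z al true)
  (fun n n0 => (Phi_annih n n0).1) (fun n n0 => (Phi_annih n n0).2) L0u' W0u'.
have spanI y : neg_span vir quad (Phi u') y -> a_ideal y.
  elim=> {y} [||d y y' _ Iy _ Iy'|n y n0 _ Iy|n y n0 _ _].
  - exact: Iu'.
  - exact: a_ideal0.
  - exact: a_idealP.
  - exact: a_ideal_virN.
  - exact: a_ideal_quadN.
have sing q e : (q <= P)%N -> afree e -> fcoef e (vir q.+1%:Z (Phi u)) = 0.
  move=> _ ea; apply: (spanI _ _ e ea); rewrite -PhiL.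
  apply: (submod_gen_stable PhiP Phi_stable _ _ stable (neg_span_in _ _ _)).
  - exact: neg_span0.
  - by move=> d x y; exact: neg_spanP.
  - exact: subsingular_annihilated sub_u _.
have T0 : z true + al true * P%:R != 0.
  have -> : z true + al true * P%:R = al true * (P.+1%:R * 2).
    by rewrite zE -!natr1; ring.
  by rewrite !mulf_neq0 ?pnatr_eq0.
have LpowE : Phi (uL K (- P.+1%:Z) ^+ r.+1 *: v) = Lpow F z al P r.+1.
  exact: (Phi_Lpow Phiv PhiL).
have uE : a_ideal (Phi u - Lpow F z al P r.+1).
  rewrite -LpowE.
  apply: (lowest_component_mod PhiP (S := a_ideal)
    a_ideal0 (@a_idealP) _ low_u).
  - move=> [s t] s0; rewrite (Phi_pbw Phiv PhiL PhiW) /=.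
    have /andP[_] := valP s; move: s0; rewrite /Wdeg /=.
    case: (val s) => [//|m s'] _; rewrite inE negb_or => /andP[m0 _] /=.
    by apply: a_ideal_quadN; lia.
  - rewrite LpowE => /(_ _ (afree_bpow P r.+1)).
    have := fcoef_Lpow_top F z al P (r := r.+1) (afree_bpow P r.+1).
    rewrite mdeg_bpow eqxx => /(_ (leqnn _)) -> /eqP.
    by rewrite expf_eq0 (negPf T0) andbF.
have fE e : afree e -> fcoef e (Phi u) = fcoef e (Lpow F z al P r.+1).
  by move=> /uE /eqP; rewrite fcoefD fcoefN subr_eq0 => /eqP.
exact: obstruction al_neq0 zE fE sing.
Qed.

End CentralChargeNonzero.

Lemma subsingular_weight_central_neq0 (K : numClosedFieldType) (c h hW : K)
    (P r : nat) (u' u : verma c h hW) : c != 0 ->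
    2 * hW + (P.+1%:R ^+ 2 - 1) / 12 * c = 0 ->
    singular u' -> L0_eigenvector (h + P.+1%:R) u' -> Wspan u' ->
    subsingular u' u ->
    lowest_component u (uL K (- P.+1%:Z) ^+ r.+1 *: verma_vac c h hW) ->
  h = hW + (13 * P.+1%:R + 1) * (P.+1%:R - 1) / 12 - r%:R * P.+1%:R / 2.
Proof.
move=> c0 hcp sing_u' wt_u' W_u' sub_u low_u.
have [a aE] : exists a : K, a ^+ 2 = - c / 12.
  by exists (sqrtC (- c / 12)); exact: sqrtCK.
have a0 : a != 0.
  by rewrite -sqrf_eq0 aE mulf_neq0 ?oppr_eq0 ?invr_eq0 ?pnatr_eq0.
have P0 : P.+1%:R != 0 :> K by rewrite pnatr_eq0.
have cE : c = - 12 * a ^+ 2 by rewrite aE; field.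
have hWE : hW = (P.+1%:R ^+ 2 - 1) / 2 * a ^+ 2.
  have -> : hW = - ((P.+1%:R ^+ 2 - 1) / 12 * c) / 2.
    by move/eqP: hcp; rewrite addrC addr_eq0 => /eqP ->; field.
  by rewrite cE; field.
(* [be] is forced by the central charge, then [b0] by the weight. *)
pose be := (2 - c) / (24 * a).
pose b0 := (h + be * (a * P.+2%:R)) / (a * P.+1%:R).
pose al (s : bool) := if s then a else be.
pose z (s : bool) := if s then a * P.+2%:R else b0.
have P2E : P.+2%:R = P.+1%:R + 1 :> K by rewrite natr1.
have P1E : P%:R = P.+1%:R - 1 :> K by rewrite -natr1 addrK.
have H1 : 2 - 24 * al true * al false = c by rewrite /al /be; field.
have H2 : vacuum_weight z al = h.
  rewrite /vacuum_weight /z /al /b0 P2E.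
  by move: P.+1%:R P0 => p p0; field; rewrite a0 p0.
have H3 : z true ^+ 2 / 2 - al true * z true = hW.
  by rewrite hWE /z /al P2E; field.
have := subsingular_obstruction (z := z) (al := al) (polynomial_fock_space K)
  a0 (erefl _) aE H1 H2 H3 sing_u' wt_u' W_u' sub_u low_u.
rewrite hWE /z /al /b0 /be P2E P1E cE.
move: P.+1%:R P0 => p p0 E.
apply/eqP; rewrite -subr_eq0 -[X in _ == X](mulr0 (2^-1)) -E; apply/eqP.
by field; rewrite a0 p0.
Qed.

(** * Zero central charge *)

Section CentralChargeZero.
Variables (K : numFieldType) (F : fock_space K) (z al : bool -> K).
Local Notation vir := (@vir K F z al).
Local Notation quad := (@quad K F z al).
Local Notation M := (F * F)%type.

(** The anomalies of the two quadratic currents are proportional to the squares of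
    the background charges, so this combination has none. *)
Definition null_quad n (f : F) : F :=
  al false ^+ 2 *: quad true n f - al true ^+ 2 *: quad false n f.

(** Two copies of Fock space with [W] mapping the first to the second: products
    of two [W]'s vanish, so they commute trivially. *)
Definition vir2 n (x : M) : M := (vir n x.1, vir n x.2).
Definition nil2 n (x : M) : M := (0, null_quad n x.1).
Definition vac2 : M := (vac F, 0).

Lemma pair_ext (x y : M) : x.1 = y.1 -> x.2 = y.2 -> x = y.
Proof. by case: x y => [? ?] [? ?] /= -> ->. Qed.

Fact null_quad_is_linear n : linear (null_quad n).
Proof.
move=> a f g; rewrite /null_quad !(quad_is_linear z al).
by to_coefs; ring.
Qed.

Fact vir2_is_linear n : linear (vir2 n).
Proof. by move=> a x y; rewrite /vir2 /= !virP. Qed.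

Fact nil2_is_linear n : linear (nil2 n).
Proof.
move=> a x y; apply: pair_ext => /=; first by rewrite scaler0 addr0.
exact: null_quad_is_linear.
Qed.

Lemma null_quad0 n : null_quad n 0 = 0.
Proof.
by have := null_quad_is_linear n (-1) 0 0; rewrite !scaleN1r !addNr.
Qed.

Lemma vir_null_quad n m f : vir n (null_quad m f) =
  null_quad m (vir n f) + (n - m)%:~R *: null_quad (n + m) f.
Proof.
by rewrite /null_quad virB !virZ !vir_quad; case: eqP => _; to_coefs; ring.
Qed.

Variable h : K.
Hypothesis alE : 2 - 24 * al true * al false = 0.
Hypothesis hE : vacuum_weight z al = h.
Hypothesis null_weight : al false ^+ 2 * (z true ^+ 2 / 2 - al true * z true)
  - al true ^+ 2 * (z false ^+ 2 / 2 - al false * z false) = 0.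
Hypothesis zt_neq0 : z true != 0.
Hypothesis al_neq0 : al false != 0.

Lemma vir2_vir2 n m x : vir2 n (vir2 m x) =
  vir2 m (vir2 n x) + (n - m)%:~R *: vir2 (n + m) x + central_term 0 n m *: x.
Proof.
have c0 : central_term (0 : K) n m = 0 by rewrite /central_term mulr0 if_same.
rewrite c0 scale0r addr0; apply: pair_ext => /=.
  by rewrite (vir_vir z al n m) alE mulr0 if_same scale0r addr0.
by rewrite (vir_vir z al n m) alE mulr0 if_same scale0r addr0.
Qed.

Lemma vir2_nil2 n m x : vir2 n (nil2 m x) =
  nil2 m (vir2 n x) + (n - m)%:~R *: nil2 (n + m) x + central_term 0 n m *: x.
Proof.
have c0 : central_term (0 : K) n m = 0 by rewrite /central_term mulr0 if_same.
rewrite c0 scale0r addr0; apply: pair_ext => /=; last exact: vir_null_quad.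
by rewrite raddf0 scaler0 addr0.
Qed.

Lemma nil2C n m x : nil2 n (nil2 m x) = nil2 m (nil2 n x).
Proof. by rewrite /nil2 /= !null_quad0. Qed.

Lemma vir2_vac n : 0 < n -> vir2 n vac2 = 0.
Proof. by move=> n0; rewrite /vir2 /= vir_vac // raddf0. Qed.

Lemma null_quad_vac n : 0 < n -> null_quad n (vac F) = 0.
Proof. by move=> n0; rewrite /null_quad !quad_vac // !scaler0 subrr. Qed.

Lemma nil2_vac n : 0 < n -> nil2 n vac2 = 0.
Proof. by move=> n0; rewrite /nil2 /= null_quad_vac. Qed.

Lemma vir2_0_vac : vir2 0 vac2 = h *: vac2.
Proof.
by apply: pair_ext => /=; [rewrite vir0_vac hE | rewrite raddf0 scaler0].
Qed.

Lemma nil2_0_vac : nil2 0 vac2 = 0 *: vac2.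
Proof.
rewrite scale0r; apply: pair_ext => //=.
by rewrite /null_quad !quad0_vac !scalerA -scalerBl null_weight scale0r.
Qed.

Lemma null_quadN1_vac_neq0 : null_quad (-1) (vac F) != 0.
Proof.
apply/eqP => /(congr1 (fcoef U_((true, 0%N)))).
rewrite /null_quad !quadN1_vac fcoefD fcoefN !fcoefZ fcoef0.
have -> : fcoef U_((true, 0%N)) (mulvar (true, 0%N) (vac F)) = 1.
  by rewrite -[U_(_)]mul1m fcoef_mulvar fcoef_vac eqxx.
rewrite fcoef_mulvar0; last by rewrite cmU.
move/eqP; rewrite !mulr0 subr0 mulr1 mulf_eq0 sqrf_eq0.
by rewrite (negPf al_neq0) (negPf zt_neq0).
Qed.

Lemma vir_null_quadN_vac P : (0 < P)%N ->
  vir P%:Z (null_quad (- P.+1%:Z) (vac F)) != 0.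
Proof.
move=> P0; rewrite vir_null_quad vir_vac // null_quad0 add0r.
have -> : P%:Z - - P.+1%:Z = (P + P.+1)%N%:Z by lia.
have -> : P%:Z + - P.+1%:Z = -1 by lia.
by rewrite scaler_eq0 negb_or null_quadN1_vac_neq0 andbT pnatr_eq0; lia.
Qed.

Local Notation V := (verma (0 : K) h 0).
Local Notation v := (verma_vac (0 : K) h 0).

(** Products of two [W]'s act by zero and [W_{-p} v] has a nonzero image, so the
    image of [u'] is that of [W_{-p} v]; but [L_{p-1}] does not kill it. *)
Lemma no_singular_W_vector P (u' : V) : (0 < P)%N -> singular u' ->
  ~ lowest_component u' (uW K (- P.+1%:Z) *: v).
Proof.
move=> P0 sing_u' [f [d [fE low lowd _]]].
have [Phi [Phiv PhiP PhiL PhiW _]] :=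
  verma_hom vir2_is_linear nil2_is_linear vir2_vir2 vir2_nil2 nil2C
    vir2_vac nil2_vac vir2_0_vac nil2_0_vac.
have PhiPbw := Phi_pbw Phiv PhiL PhiW.
have PhiWcomp d' : Phi (Wcomp 0 h 0 d' f)
    = \sum_(i <- msupp f | Wdeg i == d') f@_i *: Phi (pbw 0 h 0 i).
  by apply: etrans (Phi_sum PhiP _ _ _) _; apply: eq_bigr => i _; exact: PhiZ.
have nil0 n (x : M) : x.1 = 0 -> nil2 n x = 0.
  by move=> x10; rewrite /nil2 x10 null_quad0.
pose w := null_quad (- P.+1%:Z) (vac F).
have Phi_w : Phi (uW K (- P.+1%:Z) *: v) = (0, w) by rewrite PhiW Phiv.
have w_neq0 : w != 0.
  by apply: contraNneq (vir_null_quadN_vac P0); rewrite -/w => ->; rewrite raddf0.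
have deg2 i : (1 < Wdeg i)%N -> Phi (pbw 0 h 0 i) = 0.
  rewrite PhiPbw /Wdeg; case: (val i.1) => [|m [|m' s]] //= _.
  exact: nil0.
have deg0 i : Wdeg i == 0%N -> (Phi (pbw 0 h 0 i)).2 = 0.
  move=> /eqP di; rewrite PhiPbw (size0nil di) /=.
  by elim: (val i.2) => //= m s IH; rewrite IH raddf0.
have d1 : d = 1%N.
  case: d low lowd => [|[//|d]] _ wE.
    case/eqP: w_neq0; have <- : (Phi (uW K (- P.+1%:Z) *: v)).2 = w by rewrite Phi_w.
    rewrite -wE PhiWcomp; elim/big_rec: _ => //= i x di ->.
    by rewrite deg0 // scaler0 addr0.
  case/eqP: w_neq0; have <- : (Phi (uW K (- P.+1%:Z) *: v)).2 = w by rewrite Phi_w.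
  rewrite -wE PhiWcomp big1 // => i /eqP di.
  by rewrite deg2 ?di // scaler0.
have PhiuE : Phi u' = (0, w).
  rewrite fE (Phi_lincomb PhiP) (bigID (fun i => Wdeg i == 0%N)) /=.
  rewrite -PhiWcomp low ?d1 // (Phi0 PhiP) add0r -Phi_w -lowd d1 PhiWcomp.
  rewrite (bigID (fun i => Wdeg i == 1%N)) /= [X in _ + X]big1 ?addr0.
    by apply: eq_bigl => i; case: (Wdeg i) => [|[|]].
  by move=> i; case/andP => d0 d1'; rewrite deg2 ?scaler0 //; lia.
have [Lu _] := singular_annihilated PhiP PhiL PhiW (n := P%:Z) sing_u' P0.
move: Lu; rewrite PhiuE => /(congr1 snd) /= /eqP.
exact/negP/vir_null_quadN_vac.
Qed.

Lemma vir1_Lpow r : vir 1 (Lpow F z al 0 r.+1)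
  = (r.+1%:R * (2 * h + r%:R)) *: Lpow F z al 0 r.
Proof.
have wt k : vir 0 (Lpow F z al 0 k) = (h + k%:R) *: Lpow F z al 0 k.
  elim: k => [|k IH] /=; first by rewrite vir0_vac hE addr0.
  rewrite (vir_vir z al 0) IH virZ alE mulr0 ?if_same scale0r addr0.
  rewrite (_ : 0 - Negz 0 = 1) // (_ : 0 + Negz 0 = Negz 0) //.
  by rewrite -scalerDl -natr1 addrA.
elim: r => [|r IH].
  rewrite /= (vir_vir z al 1) vir_vac // raddf0 add0r alE mulr0 ?if_same scale0r addr0.
  by rewrite (_ : 1 + Negz 0 = 0) // vir0_vac hE scalerA; congr (_ *: _); ring.
have LpowS k : Lpow F z al 0 k.+1 = vir (Negz 0) (Lpow F z al 0 k) by [].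
rewrite (LpowS r.+1) (vir_vir z al 1) IH virZ -LpowS alE mulr0 ?if_same scale0r addr0.
rewrite (_ : 1 + Negz 0 = 0) // wt.
by rewrite scalerA -scalerDl; congr (_ *: _); rewrite -!natr1; ring.
Qed.

Lemma iter_vir2 k : (iter k (vir2 (- 1%:Z)) vac2).1 = Lpow F z al 0 k.
Proof.
elim: k => [//|k IH]; rewrite iterS /vir2 [LHS]/= -/(vir2 _) IH.
exact: erefl.
Qed.

(** Projecting to the first copy kills all [W_n] and the vector [u'], whose image
    would be a multiple of the vacuum of the wrong weight. *)
Lemma subsingular_weight_one r (u' u : V) :
    L0_eigenvector (h + 1%:R) u' -> Wspan u' -> subsingular u' u ->
    lowest_component u (uL K (- 1%:Z) ^+ r.+1 *: v) ->
  2 * h + r%:R = 0.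
Proof.
move=> [_ wt_u'] W_u' sub_u low_u.
have [Phi [Phiv PhiP PhiL PhiW Phi_stable]] :=
  verma_hom vir2_is_linear nil2_is_linear vir2_vir2 vir2_nil2 nil2C
    vir2_vac nil2_vac vir2_0_vac nil2_0_vac.
pose S (x : M) := x.1 = 0.
have S0 : S 0 by [].
have SP a x y : S x -> S y -> S (a *: x + y).
  by rewrite /S /= => -> ->; rewrite scaler0 addr0.
have Sst n x : S x -> S (vir2 n x) /\ S (nil2 n x).
  move=> Sx; split; last by rewrite /S.
  by rewrite /S /vir2 /= (Sx : x.1 = 0) (raddf0 (vir n)).
have Su' : S (Phi u').
  have [k kE] : exists k, (Phi u').1 = k *: vac F.
    apply: (Wspan_ind Phiv PhiP PhiW
      (P := fun x : M => exists k, x.1 = k *: vac F)) W_u'.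
    - by exists 0; rewrite scale0r.
    - move=> a x y [k kE] [k' k'E]; exists (a * k + k').
      by rewrite /= kE k'E scalerDl scalerA.
    - case=> [|m s] _; first by exists 1; rewrite scale1r.
      by exists 0; rewrite scale0r.
  have E1 : (Phi (uL K 0 *: u')).1 = k *: (h *: vac F).
    by rewrite PhiL /vir2 [LHS]/= kE virZ vir0_vac hE.
  have E2 : (Phi (uL K 0 *: u')).1 = (h + 1%:R) *: (k *: vac F).
    by rewrite wt_u' (PhiZ PhiP) -kE.
  have : fcoef (@mone _) (k *: (h *: vac F))
      = fcoef (@mone _) ((h + 1%:R) *: (k *: vac F)).
    by rewrite -E1 -E2.
  rewrite !fcoefZ fcoef_vac eqxx !mulr1 mulrDl mul1r mulrC => /eqP.
  rewrite -subr_eq0 opprD addrA subrr add0r oppr_eq0 /S kE => /eqP ->.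
  by rewrite scale0r.
have T0 : z true + al true * 0 != 0 by rewrite mulr0 addr0.
have Lpow_neq0 k : Lpow F z al 0 k <> 0.
  move=> L0; have := fcoef_Lpow_top F z al 0 (r := k) (afree_bpow 0 k).
  rewrite mdeg_bpow eqxx L0 fcoef0 => /(_ (leqnn _)) /esym/eqP.
  by rewrite expf_eq0 (negPf T0) andbF.
have PhiL1 : (Phi (uL K (- 1%:Z) ^+ r.+1 *: v)).1 = Lpow F z al 0 r.+1.
  have -> : Phi (uL K (- 1%:Z) ^+ r.+1 *: v) = iter r.+1 (vir2 (- 1%:Z)) vac2.
    exact: (Phi_Lpow Phiv PhiL).
  exact: iter_vir2.
have uE : S (Phi u - Phi (uL K (- 1%:Z) ^+ r.+1 *: v)).
  apply: (lowest_component_mod PhiP (S := S) S0 SP _ low_u).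
  - move=> [s t] s0; rewrite (Phi_pbw Phiv PhiL PhiW) /S /=.
    by move: s0; rewrite /Wdeg /=; case: (val s).
  - by rewrite /S PhiL1; exact: Lpow_neq0.
have Phiu : (Phi u).1 = Lpow F z al 0 r.+1.
  by apply/eqP; rewrite -subr_eq0 -PhiL1; apply/eqP; exact: uE.
have J1 := subsingular_annihilated sub_u (isT : 0 < (1 : int)).
have := submod_gen_stable PhiP Phi_stable S0 SP Sst Su' J1.
rewrite /S PhiL /vir2 [LHS]/= Phiu vir1_Lpow => E.
have := congr1 (fcoef (bpow 0 r)) E; rewrite fcoefZ fcoef0 => /eqP.
have := fcoef_Lpow_top F z al 0 (r := r) (afree_bpow 0 r).
rewrite mdeg_bpow eqxx => /(_ (leqnn _)) ->.
rewrite !mulf_eq0 expf_eq0 (negPf T0) andbF orbF pnatr_eq0 /=.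
by move/eqP.
Qed.

End CentralChargeZero.

Lemma subsingular_weight_central_eq0 (K : numClosedFieldType) (h : K)
    (P r : nat) (u' u : verma 0 h 0) :
    singular u' -> L0_eigenvector (h + P.+1%:R) u' -> Wspan u' ->
    lowest_component u' (uW K (- P.+1%:Z) *: verma_vac 0 h 0) ->
    subsingular u' u ->
    lowest_component u (uL K (- P.+1%:Z) ^+ r.+1 *: verma_vac 0 h 0) ->
  P = 0%N /\ 2 * h + r%:R = 0.
Proof.
move=> sing_u' wt_u' W_u' low_u' sub_u low_u.
(* The zero modes [A] and [(2 - A) / 12] give [W_0 v = 0], and the weight is [h]
   when [A] solves this equation; one of its two roots is nonzero. *)
have [A [A0 AE]] : exists A : K, A != 0 /\ (A - 1) ^+ 2 = - (12 * h + 1).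
  pose s : K := sqrtC (- (12 * h + 1)).
  have sE : s ^+ 2 = - (12 * h + 1) by exact: sqrtCK.
  have [s1|s1] := eqVneq (1 + s) 0; last first.
    by exists (1 + s); split=> //; rewrite addrAC subrr add0r.
  exists (1 - s); split; last by rewrite addrAC subrr add0r sqrrN.
  have -> : s = -1 by apply/eqP; rewrite -addr_eq0 addrC s1.
  by rewrite opprK -[1 + 1]/(2%:R) pnatr_eq0.
pose al (s : bool) : K := if s then 1 else 12^-1.
pose z (s : bool) : K := if s then A else (2 - A) / 12.
have hE0 : h = - ((A - 1) ^+ 2 + 1) / 12 by rewrite AE; field.
have H1 : 2 - 24 * al true * al false = 0 by rewrite /al; field.
have H2 : vacuum_weight z al = h by rewrite hE0 /vacuum_weight /z /al; field.
have H3 : al false ^+ 2 * (z true ^+ 2 / 2 - al true * z true)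
  - al true ^+ 2 * (z false ^+ 2 / 2 - al false * z false) = 0.
  by rewrite /z /al; field.
have H4 : al false != 0 by rewrite /al invr_eq0 pnatr_eq0.
have F := polynomial_fock_space K.
case: P => [|P] in wt_u' low_u' low_u *.
  split; first exact: erefl.
  have weight_one := subsingular_weight_one (z := z) (al := al) F H1 H2 H3 A0.
  exact: weight_one r u' u wt_u' W_u' sub_u low_u.
by case: (no_singular_W_vector (z := z) (al := al) F H1 H2 H3 A0 H4
  (isT : (0 < P.+1)%N) sing_u' low_u').
Qed.

Theorem theorem13 (R : realType) (c h hW : R[i]) (p : nat)
  (hp : (0 < p)%N)
  (hcp : 2 * hW + (p%:R ^+ 2 - 1) / 12 * c = 0)
  (u' : verma c h hW)
  (hu'sing : singular u')
  (hu'wt : L0_eigenvector (h + p%:R) u')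
  (hu'W : Wspan u')
  (hu'low : lowest_component u' (uW _ (- p%:Z) *: verma_vac c h hW))
  (u : verma c h hW)
  (hu : subsingular u' u)
  (r : nat) (hr : (0 < r)%N)
  (hulow : lowest_component u (uL _ (- p%:Z) ^+ r *: verma_vac c h hW)) :
  h = hW + (13 * p%:R + 1) * (p%:R - 1) / 12 + (1 - r%:R) * p%:R / 2.
Proof.
case: p hp hcp hu'wt hu'low hulow => [//|P] _ hcp hu'wt hu'low hulow.
case: r hr hulow => [//|r] _ hulow.
have -> : (1 - r.+1%:R) * P.+1%:R / 2 = - (r%:R * P.+1%:R / 2) :> R[i].
  by rewrite -natr1; field.
have [c0|c0] := eqVneq c 0; last first.
  exact: subsingular_weight_central_neq0 c0 hcp hu'sing hu'wt hu'W hu hulow.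
have hW0 : hW = 0.
  by move: hcp; rewrite c0 mulr0 addr0 => /eqP; rewrite mulf_eq0 pnatr_eq0 => /eqP.
subst c hW.
have [P0 hr] := subsingular_weight_central_eq0 hu'sing hu'wt hu'W hu'low hu hulow.
have -> : h = - r%:R / 2.
  have -> : r%:R = - (2 * h) by apply/eqP; rewrite -addr_eq0 addrC hr.
  by field.
by rewrite P0; field.
Qed.
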